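(* Let $k\ge1$ be an integer, let $f_1,f_2,f_3,f_4\in\mathbb{C}[x_1,x_2,x_3]$ be general forms of degree $2$, and let $R_{3,2,k}=\mathbb{C}[x_1,x_2,x_3]/(f_1,f_2,f_3,f_4)^k$. Then the Hilbert series of $R_{3,2,k}$ is $$\sum_{i=0}^{2k-1}\binom{i+2}{2}t^i+(3k-1)t^{2k}.$$
   Context: A form is a homogeneous polynomial. ''General forms'' means: the statement holds for all $(f_1,\dots,f_4)$ in some nonempty Zariski-open subset (depending on $k$) of the space of $4$-tuples of forms of degree $2$ in $\mathbb{C}[x_1,x_2,x_3]$. The Hilbert series of a graded algebra $R=\bigoplus_i R_i$ is $\sum_i \dim_{\mathbb{C}}(R_i)\,t^i$. *)

(* Defs.v *)
From HB Require Import structures.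
From mathcomp Require Import all_boot all_order all_algebra.
From mathcomp Require Import classical_sets boolp reals.
From mathcomp Require Import complex mpoly.

Set Implicit Arguments.
Unset Strict Implicit.
Unset Printing Implicit Defensive.

Import GRing.Theory.

Local Open Scope ring_scope.
Local Open Scope classical_set_scope.

(* ring_quotient's [idealr] covers proper ideals only; here the unit ideal is  *)
(* allowed, so that quotients are possibly trivial rings.                     *)
HB.mixin Record isMulAbsorbing (A : comNzRingType) (I : A -> bool) := {
  absorbMl : forall a, {in I, forall u, a * u \in I}
}.

#[short(type="ideal")]
HB.structure Definition Ideal (A : comNzRingType) :=
  {I of GRing.ZmodClosed A I & isMulAbsorbing A I}.

Section GeneratedIdeal.
Variables (A : comNzRingType) (X : set A).

Definition ideal_gen : {pred A} := fun x =>
  `[< exists m (a g : 'I_m -> A),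
        (forall i, X (g i)) /\ x = \sum_(i < m) a i * g i >].

Lemma ideal_genMl a : {in ideal_gen, forall u, a * u \in ideal_gen}.
Proof.
move=> u /asboolP[m [b [g [Xg ->]]]]; apply/asboolP.
exists m, (fun i => a * b i), g; split=> //.
by rewrite mulr_sumr; apply: eq_bigr => i _; rewrite mulrA.
Qed.

Lemma ideal_gen_zmod_closed : zmod_closed ideal_gen.
Proof.
split; first by apply/asboolP; exists 0, (fun=> 0), (fun=> 0); split;
  [case | rewrite big_ord0].
move=> u v uI vI.
have {vI} : -1 * v \in ideal_gen by exact: ideal_genMl.
rewrite mulN1r; move: (- v) => w {v} wI.
case/asboolP: uI => [m [a [g [Xg ->]]]]; case/asboolP: wI => [p [b [h [Xh ->]]]].
apply/asboolP; exists (m + p)%N.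
exists (fun i => match split i with inl j => a j | inr j => b j end).
exists (fun i => match split i with inl j => g j | inr j => h j end).
split; first by move=> i; case: (split i).
rewrite big_split_ord /=; congr (_ + _); apply: eq_bigr => i _.
  by rewrite (unsplitK (inl i)).
by rewrite (unsplitK (inr i)).
Qed.

HB.instance Definition _ :=
  GRing.isZmodClosed.Build A ideal_gen ideal_gen_zmod_closed.
HB.instance Definition _ := isMulAbsorbing.Build A ideal_gen ideal_genMl.

End GeneratedIdeal.

Definition ideal_exp (A : comNzRingType) (I : ideal A) (k : nat) : ideal A :=
  ideal_gen [set x | exists g : 'I_k -> A,
                       (forall j, g j \in I) /\ x = \prod_(j < k) g j].

Section QuotientAlgebra.
Variables (K : fieldType) (A : comAlgType K) (I : ideal A).
Local Open Scope quotient_scope.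

Definition quotient := {ideal_quot I}.

HB.instance Definition _ := GRing.Zmodule.on quotient.

Definition quotient_proj (x : A) : quotient := \pi_({ideal_quot I}) x.
Local Notation proj := quotient_proj.

Lemma quotient_projP (x y : A) : proj x = proj y <-> x - y \in I.
Proof.
rewrite -[x - y \in I]/(Quotient.equiv I x y) /quotient_proj.
by split=> [/eqP|?]; [|apply/eqP]; rewrite piE.
Qed.

Lemma quotient_proj_is_zmod_morphism : zmod_morphism proj.
Proof. by move=> x y; rewrite /quotient_proj raddfB. Qed.

HB.instance Definition _ :=
  GRing.isZmodMorphism.Build A quotient proj quotient_proj_is_zmod_morphism.

Let lift (x : quotient) : A := repr (x : {ideal_quot I}).

Let liftK x : proj (lift x) = x. Proof. exact: reprK. Qed.

Let lift_proj x : lift (proj x) - x \in I.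
Proof. by apply/quotient_projP; rewrite liftK. Qed.

Definition quotient_one := proj 1.
Definition quotient_mul x y := proj (lift x * lift y).
Definition quotient_scale (c : K) x := proj (c *: lift x).

Let projM x y : proj (x * y) = quotient_mul (proj x) (proj y).
Proof.
apply/esym/quotient_projP; set x' := lift _; set y' := lift _.
have -> : x' * y' - x * y = x' * (y' - y) + y * (x' - x).
  by rewrite !mulrBr [y * x']mulrC [y * x]mulrC addrA subrK.
by rewrite rpredD // absorbMl // lift_proj.
Qed.

Let projZ c x : proj (c *: x) = quotient_scale c (proj x).
Proof.
apply/esym/quotient_projP; set x' := lift _.
by rewrite -scalerBr -mulr_algl absorbMl // lift_proj.
Qed.

Fact quotient_mulA : associative quotient_mul.
Proof.
move=> x y z; rewrite -[x]liftK -[y]liftK -[z]liftK.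
by rewrite -!projM mulrA.
Qed.

Fact quotient_mulC : commutative quotient_mul.
Proof. by move=> x y; rewrite /quotient_mul mulrC. Qed.

Fact quotient_mul1 : left_id quotient_one quotient_mul.
Proof. by move=> x; rewrite -[x]liftK -projM mul1r. Qed.

Fact quotient_mulDl : left_distributive quotient_mul +%R.
Proof.
move=> x y z; rewrite -[x]liftK -[y]liftK -[z]liftK.
by rewrite -raddfD -!projM -raddfD mulrDl.
Qed.

HB.instance Definition _ := GRing.Zmodule_isComPzRing.Build quotient
  quotient_mulA quotient_mulC quotient_mul1 quotient_mulDl.

Fact quotient_scaleA a b x :
  quotient_scale a (quotient_scale b x) = quotient_scale (a * b) x.
Proof. by rewrite -[x]liftK -!projZ scalerA. Qed.

Fact quotient_scale1 : left_id 1 quotient_scale.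
Proof. by move=> x; rewrite -[x]liftK -projZ scale1r. Qed.

Fact quotient_scaleDr : right_distributive quotient_scale +%R.
Proof.
move=> a x y; rewrite -[x]liftK -[y]liftK.
by rewrite -raddfD -!projZ -raddfD scalerDr.
Qed.

Fact quotient_scaleDl x :
  {morph quotient_scale^~ x : a b / a + b >-> a + b}.
Proof.
by move=> a b; rewrite -[x]liftK -!projZ -raddfD scalerDl.
Qed.

HB.instance Definition _ := GRing.Zmodule_isLmodule.Build K quotient
  quotient_scaleA quotient_scale1 quotient_scaleDr quotient_scaleDl.

Lemma quotient_proj_is_monoid_morphism : monoid_morphism proj.
Proof. by split=> // x y; rewrite projM. Qed.

HB.instance Definition _ := GRing.isMonoidMorphism.Build A quotient proj
  quotient_proj_is_monoid_morphism.

Lemma quotient_proj_is_scalable : scalable proj.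
Proof. by move=> c x; rewrite projZ. Qed.

HB.instance Definition _ :=
  GRing.isScalable.Build K A quotient *:%R proj quotient_proj_is_scalable.

End QuotientAlgebra.

Definition has_dim (K : fieldType) (V : lmodType K) (W : set V) (m : nat) :=
  exists b : 'I_m -> V,
    (forall c : 'I_m -> K, \sum_(i < m) c i *: b i = 0 -> forall i, c i = 0) /\
    W = [set v | exists c : 'I_m -> K, v = \sum_(i < m) c i *: b i].

(* The formal power series with coefficients in nat is encoded by its         *)
(* coefficient sequence [H]; [V_ d] is the component of degree [d] of [V].    *)
Definition is_hilbert_series (K : fieldType) (V : lmodType K)
    (V_ : nat -> set V) (H : nat -> nat) :=
  forall d, has_dim (V_ d) (H d).

Definition graded_piece (K : fieldType) (n : nat) (I : ideal {mpoly K[n]})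
    (d : nat) : set (quotient I) :=
  [set quotient_proj I p | p in [set p : {mpoly K[n]} | p \is d.-homog]].

Arguments graded_piece {K n} I d _.

Section Generic.
Variables (K : fieldType) (V : vectType K).

(* A polynomial function on [V] is a polynomial in coordinates; the resulting *)
(* topology does not depend on the choice of a basis.                         *)
Definition zariski_closed (Z : set V) :=
  exists P : set {mpoly K[\dim {:V}]},
    Z = [set v | forall p, P p ->
                   p.@[fun i => coord (vbasis {:V}) i v] = 0].

Definition zariski_open (U : set V) := zariski_closed (~` U).

Definition holds_generically (Q : set V) :=
  exists U : set V, [/\ zariski_open U, U !=set0 & U `<=` Q].

End Generic.

Definition forms_ideal (K : fieldType) (n d r : nat)
    (f : 'I_r -> dhomog n K d) : ideal {mpoly K[n]} :=
  ideal_gen [set mpoly_of_dhomog (f i) | i in [set: 'I_r]].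

(* Main.v *)
Require Import Defs.
From HB Require Import structures.
From mathcomp Require Import all_boot all_order all_algebra.
From mathcomp Require Import classical_sets boolp reals.
From mathcomp Require Import complex mpoly ring zify.

(* Four general quadrics span the space of quadrics apolar to a pencil of dual
   conics. Diagonalizing the pencil gives a basis x, y, z of the linear forms
   such that the ideal I of the quadrics is (xy, yz, zx, x^2 + y^2 + z^2); the
   quadrics then parametrize a Steiner quartic surface, which is singular along
   the images of the lines x = 0, y = 0 and z = 0. In degree 2k, modulo I^k, the
   monomials divisible by xyz vanish, y^a z^b is opposite to y^b z^a, and
   x^2k + y^2k + z^2k vanishes, so that 3k - 1 monomials remain; in degree
   2k + 1 every monomial vanishes. Conversely, the component of degree 2k of an
   element of I^k is symmetric in y and z on the line x = 0 (and so on), because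
   this holds for the generators; hence the remaining monomials are independent.
   The pencil can be diagonalized when one polynomial in the coefficients of the
   quadrics, essentially the discriminant of the pencil, does not vanish. *)

Set Implicit Arguments.
Unset Strict Implicit.
Unset Printing Implicit Defensive.

Import GRing.Theory Num.Theory.
Local Open Scope ring_scope.
Local Open Scope classical_set_scope.

(** * Powers of the Steiner ideal *)

Section IdealPowers.
Variables (A : comNzRingType) (I : ideal A).

Lemma ideal_exp_prod m n (g : 'I_m -> A) :
  m = n -> (forall i, g i \in I) -> \prod_i g i \in ideal_exp I n.
Proof.
move=> <- gI; apply/asboolP; exists 1%N, (fun=> 1), (fun=> \prod_i g i).
by split=> [_|]; [exists g | rewrite big_ord1 mul1r].
Qed.

Lemma ideal_exp0 a : a \in ideal_exp I 0.
Proof.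
rewrite -[a]mulr1 absorbMl //.
have -> : 1 = \prod_(i < 0) (1 : A) by rewrite big_ord0.
by apply: ideal_exp_prod => // -[].
Qed.

Lemma ideal_exp1 a : a \in I -> a \in ideal_exp I 1.
Proof.
move=> aI; have -> : a = \prod_(i < 1) a by rewrite big_ord1.
exact: ideal_exp_prod.
Qed.

Lemma ideal_expM m n a b :
  a \in ideal_exp I m -> b \in ideal_exp I n -> a * b \in ideal_exp I (m + n).
Proof.
case/asboolP => [r [c [g [gP ->]]]] /asboolP[s [d [h [hP ->]]]].
rewrite mulr_suml; apply: rpred_sum => i _.
rewrite mulr_sumr; apply: rpred_sum => j _.
have [u [uI ->]] := gP i; have [v [vI ->]] := hP j.
rewrite mulrACA absorbMl //.
have -> : (\prod_i u i) * (\prod_i v i)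
    = \prod_(t < m + n) (match split t with inl e => u e | inr e => v e end).
  rewrite big_split_ord /=; congr (_ * _); apply: eq_bigr => t _.
    by rewrite (unsplitK (inl t)).
  by rewrite (unsplitK (inr t)).
by apply: ideal_exp_prod => // t; case: split.
Qed.

Lemma ideal_expMl k a b : b \in ideal_exp I k -> a * b \in ideal_exp I k.
Proof. exact: absorbMl. Qed.

Lemma ideal_expX n a : a \in I -> a ^+ n \in ideal_exp I n.
Proof.
move=> aI; elim: n => [|n IHn]; first exact: ideal_exp0.
by rewrite exprS -add1n ideal_expM // ideal_exp1.
Qed.

End IdealPowers.

(** * Monomial relations modulo the powers, in degrees 2k and 2k + 1 *)

Section SteinerIdeal.
Variables (A : comNzRingType) (I : ideal A).

Definition steiner_frame (x y z : A) :=
  [/\ x * y \in I, y * z \in I, z * x \in I & x ^+ 2 + y ^+ 2 + z ^+ 2 \in I].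

Lemma steiner_frame_rot x y z : steiner_frame x y z -> steiner_frame y z x.
Proof. by case=> xy yz zx q; split=> //; rewrite addrC addrA. Qed.

Lemma steiner_frame_swap x y z : steiner_frame x y z -> steiner_frame y x z.
Proof.
by case=> xy yz zx q; split; rewrite 1?[_ * _]mulrC // (addrC (y ^+ 2)).
Qed.

(** The monomial is $(xy)^a (yz)^b (zx)^c$; exponents of even sum satisfying the triangle
    inequalities are exactly those of this shape. *)
Lemma steiner_triangle x y z a b c : steiner_frame x y z ->
  x ^+ (a + c) * y ^+ (a + b) * z ^+ (b + c) \in ideal_exp I (a + b + c).
Proof.
case=> xy yz zx _.
have -> : x ^+ (a + c) * y ^+ (a + b) * z ^+ (b + c)
    = (x * y) ^+ a * (y * z) ^+ b * (z * x) ^+ c by rewrite !exprD !exprMn;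
      ring.
by rewrite !ideal_expM ?ideal_expX.
Qed.

(* [x ^+ 2] is traded for [- y ^+ 2 - z ^+ 2] until the triangle inequality
   between the exponents holds *)
Lemma steiner_obtuse x y z b c m : steiner_frame x y z ->
  x ^+ (b.+1 + c.+1 + m.*2) * y ^+ b.+1 * z ^+ c.+1
    \in ideal_exp I (b.+1 + c.+1 + m).
Proof.
move=> fr; have [_ _ _ q] := fr.
pose P m := forall b c, x ^+ (b.+1 + c.+1 + m.*2) * y ^+ b.+1 * z ^+ c.+1
    \in ideal_exp I (b.+1 + c.+1 + m).
have P0 : P 0.
  move=> {}b {}c; have := steiner_triangle b.+1 0 c.+1 fr.
  by rewrite !(addn0, add0n).
have PS n : P n ->
    (forall b c, x ^+ (b.+1 + c.+1 + n.*2) * y ^+ b.+3 * z ^+ c.+1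
       \in ideal_exp I (b.+1 + c.+1 + n.+1)) ->
    (forall b c, x ^+ (b.+1 + c.+1 + n.*2) * y ^+ b.+1 * z ^+ c.+3
       \in ideal_exp I (b.+1 + c.+1 + n.+1)) -> P n.+1.
  move=> Pn Py Pz {}b {}c.
  have -> : x ^+ (b.+1 + c.+1 + n.+1.*2) * y ^+ b.+1 * z ^+ c.+1 =
     (x ^+ (b.+1 + c.+1 + n.*2) * y ^+ b.+1 * z ^+ c.+1)
         * (x ^+ 2 + y ^+ 2 + z ^+ 2)
     - x ^+ (b.+1 + c.+1 + n.*2) * y ^+ b.+3 * z ^+ c.+1
     - x ^+ (b.+1 + c.+1 + n.*2) * y ^+ b.+1 * z ^+ c.+3.
    by rewrite doubleS !addnS !exprS; ring.
  rewrite !rpredB ?Py ?Pz //.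
  by rewrite -(addn1 n) addnA ideal_expM ?Pn ?ideal_exp1.
(* Moving a square from [x] to [y] or [z] lowers the excess [m] by two, so two consecutive values
   are carried; from excess one it lands in the triangle case. *)
have [Pm _] : P m /\ P m.+1; last exact: Pm.
elim: m => [|n [Pn PSn]]; split=> //; apply: PS => // {}b {}c.
- have := steiner_triangle b.+2 1 c fr.
  by rewrite !(addn0, addnS, addSn, add0n, add1n).
- have := steiner_triangle b 1 c.+2 fr.
  by rewrite !(addn0, addnS, addSn, add0n, add1n).
- have := Pn b.+2 c.
  by rewrite !(addnS, addSn, doubleS).
- have := Pn b c.+2.
  by rewrite !(addnS, addSn, doubleS).
Qed.

(** Either one exponent is at least the sum of the other two, which is [steiner_obtuse] up to
    rotation, or the triangle inequalities hold and $k-c$, $k-a$, $k-b$ are the exponents of $xy$,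
    $yz$, $zx$. *)
Lemma steiner_mixed x y z a b c k : steiner_frame x y z ->
    (0 < a)%N -> (0 < b)%N -> (0 < c)%N -> (a + b + c = k.*2)%N ->
  x ^+ a * y ^+ b * z ^+ c \in ideal_exp I k.
Proof.
move=> fr a0 b0 c0 abc.
have [ha|ha] := leqP (b + c) a.
  have := steiner_obtuse b.-1 c.-1 (k - b - c) fr.
  rewrite !prednK //.
  have -> : (b + c + (k - b - c).*2 = a)%N by lia.
  by have -> : (b + c + (k - b - c) = k)%N by lia.
have [hb|hb] := leqP (c + a) b.
  have := steiner_obtuse c.-1 a.-1 (k - c - a) (steiner_frame_rot fr).
  rewrite !prednK //.
  have -> : (c + a + (k - c - a).*2 = b)%N by lia.
  have -> : (c + a + (k - c - a) = k)%N by lia.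
  by have -> : y ^+ b * z ^+ c * x ^+ a = x ^+ a * y ^+ b * z ^+ c by ring.
have [hc|hc] := leqP (a + b) c.
  have := steiner_obtuse a.-1 b.-1 (k - a - b)
    (steiner_frame_rot (steiner_frame_rot fr)).
  rewrite !prednK //.
  have -> : (a + b + (k - a - b).*2 = c)%N by lia.
  have -> : (a + b + (k - a - b) = k)%N by lia.
  by have -> : z ^+ c * x ^+ a * y ^+ b = x ^+ a * y ^+ b * z ^+ c by ring.
have := steiner_triangle (k - c) (k - a) (k - b) fr.
have -> : (k - c + (k - b) = a)%N by lia.
have -> : (k - c + (k - a) = b)%N by lia.
have -> : (k - a + (k - b) = c)%N by lia.
by rewrite subnKC //; lia.
Qed.

(* Newton's recurrence for the power sums of [y ^+ 2] and [z ^+ 2] *)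
Lemma steiner_edge x y z b m : steiner_frame x y z ->
  (y * z) ^+ b.+1 * (y ^+ m.*2 + z ^+ m.*2) \in ideal_exp I (b.+1 + m).
Proof.
move=> fr; have [_ yz _ q] := fr.
pose P m := forall b, (y * z) ^+ b.+1 * (y ^+ m.*2 + z ^+ m.*2)
    \in ideal_exp I (b.+1 + m).
suff [Pm _] : P m /\ P m.+1 by apply: Pm.
(* The generator supplies $y^2+z^2$ only up to $x^2$; the resulting error terms are divisible by
   $xyz$. *)
have mixed n c : x ^+ 2 * ((y * z) ^+ c.+1 * (y ^+ n.*2 + z ^+ n.*2))
    \in ideal_exp I (c.+1 + n.+1).
  have -> : x ^+ 2 * ((y * z) ^+ c.+1 * (y ^+ n.*2 + z ^+ n.*2))
    = x ^+ 2 * y ^+ (c.+1 + n.*2) * z ^+ c.+1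
      + x ^+ 2 * y ^+ c.+1 * z ^+ (c.+1 + n.*2).
    by rewrite exprMn !exprD; ring.
  by rewrite rpredD // (steiner_mixed fr) //; lia.
have P0 : P 0.
  by move=> c; rewrite mulrC ideal_expMl // addn0 ideal_expX.
have PS n : P n ->
    (forall c, (y * z) ^+ c.+1 * (y ^+ 2 * z ^+ n.*2 + z ^+ 2 * y ^+ n.*2)
       \in ideal_exp I (c.+1 + n.+1)) -> P n.+1.
  move=> Pn Pyz c.
  have -> : (y * z) ^+ c.+1 * (y ^+ n.+1.*2 + z ^+ n.+1.*2)
   = ((y * z) ^+ c.+1 * (y ^+ n.*2 + z ^+ n.*2)) * (x ^+ 2 + y ^+ 2 + z ^+ 2)
    - x ^+ 2 * ((y * z) ^+ c.+1 * (y ^+ n.*2 + z ^+ n.*2))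
    - (y * z) ^+ c.+1 * (y ^+ 2 * z ^+ n.*2 + z ^+ 2 * y ^+ n.*2).
    by rewrite doubleS !exprS; ring.
  by rewrite !rpredB ?Pyz ?mixed // -(addn1 n) addnA ideal_expM ?Pn ?ideal_exp1.
(* The last correction is $(yz)^2$ times the power sum of index $n-1$, hence the two-step induction;
   for $n=0$ it is $y^2+z^2$, the generator minus $x^2$. *)
elim: m => [|n [Pn PSn]]; split=> //; apply: PS => // c.
- have -> : (y * z) ^+ c.+1 * (y ^+ 2 * z ^+ 0.*2 + z ^+ 2 * y ^+ 0.*2)
    = (y * z) ^+ c.+1 * (x ^+ 2 + y ^+ 2 + z ^+ 2) - x ^+ 2 * (y * z) ^+ c.+1.
    by rewrite double0 !expr0; ring.
  rewrite rpredB //; first by rewrite ideal_expM ?ideal_expX ?ideal_exp1.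
  by rewrite exprMn mulrA (steiner_mixed fr) //; lia.
- have -> : (y * z) ^+ c.+1 * (y ^+ 2 * z ^+ n.+1.*2 + z ^+ 2 * y ^+ n.+1.*2)
    = (y * z) ^+ c.+3 * (y ^+ n.*2 + z ^+ n.*2).
    by rewrite doubleS !exprS; ring.
  by have := Pn c.+2; rewrite !(addnS, addSn).
Qed.

(** By induction: multiplying by $x^2+y^2+z^2$ creates cross terms that pair up into
    $(xy)^2(x^{2k}+y^{2k})$ and its rotations, which [steiner_edge] handles. *)
Lemma steiner_power_sum x y z k : steiner_frame x y z ->
  x ^+ k.+1.*2 + y ^+ k.+1.*2 + z ^+ k.+1.*2 \in ideal_exp I k.+1.
Proof.
move=> fr; have [_ _ _ q] := fr.
elim: k => [|k IHk]; first exact: ideal_exp1.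
have -> : x ^+ k.+2.*2 + y ^+ k.+2.*2 + z ^+ k.+2.*2 =
    (x ^+ k.+1.*2 + y ^+ k.+1.*2 + z ^+ k.+1.*2) * (x ^+ 2 + y ^+ 2 + z ^+ 2)
    - (x * y) ^+ 2 * (x ^+ k.*2 + y ^+ k.*2)
    - (y * z) ^+ 2 * (y ^+ k.*2 + z ^+ k.*2)
    - (z * x) ^+ 2 * (z ^+ k.*2 + x ^+ k.*2).
  by rewrite !doubleS !exprS; ring.
have fr' := steiner_frame_rot fr.
have fr'' := steiner_frame_rot fr'.
rewrite !rpredB // -?(add2n k) ?(steiner_edge 1 k fr) ?(steiner_edge 1 k fr')
  ?(steiner_edge 1 k fr'') //.
by rewrite add2n -[k.+2]addn1 ideal_expM // ideal_exp1.
Qed.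

(** Multiplying [steiner_edge] by [y] exchanges the monomial, up to sign, for one with [y] and [z]
    swapped and the gap between the exponents smaller by two. At gap one the monomial is
    $y(yz)^{b+1}$. *)
Lemma steiner_edge_odd x y z b m : steiner_frame x y z ->
  y ^+ (b.+1 + m.*2.+1) * z ^+ b.+1 \in ideal_exp I (b.+1 + m).
Proof.
elim: m x y z b => [|m IHm] x y z b fr.
  have [_ yz _ _] := fr.
  by rewrite addn1 addn0 exprS -mulrA -exprMn ideal_expMl // ideal_expX.
have -> : y ^+ (b.+1 + m.+1.*2.+1) * z ^+ b.+1 =
    y * ((y * z) ^+ b.+1 * (y ^+ m.+1.*2 + z ^+ m.+1.*2))
    - z ^+ (b.+2 + m.*2.+1) * y ^+ b.+2.
  by rewrite doubleS !exprMn !exprD !exprS; ring.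
rewrite rpredB //; first by rewrite ideal_expMl // (steiner_edge _ _ fr).
have -> : (b.+1 + m.+1 = b.+2 + m)%N by lia.
apply: (IHm x).
exact: steiner_frame_swap (steiner_frame_rot (steiner_frame_rot fr)).
Qed.

Lemma steiner_edge_gt x y z b c k : steiner_frame x y z ->
  (0 < b)%N -> (0 < c)%N -> (b + c = k.*2.+1)%N ->
  y ^+ b * z ^+ c \in ideal_exp I k.
Proof.
move=> fr; wlog cb : y z b c fr / (c < b)%N => [H b0 c0 bc|].
  have [cb|cb] := ltnP c b; first exact: H.
  rewrite mulrC; apply: H => //; [|lia|lia].
  exact: steiner_frame_swap (steiner_frame_rot (steiner_frame_rot fr)).
move=> b0 c0 bc.
have := steiner_edge_odd c.-1 (k - c) fr; rewrite prednK //.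
have -> : (c + (k - c).*2.+1 = b)%N by lia.
by have -> : (c + (k - c) = k)%N by lia.
Qed.

(** Multiply the power sum by [x]; the two other terms are edge monomials of degree $2k+1$. *)
Lemma steiner_vertex_gt x y z k : steiner_frame x y z -> (0 < k)%N ->
  x ^+ k.*2.+1 \in ideal_exp I k.
Proof.
move=> fr; case: k => // k _.
have fr' := steiner_frame_rot fr.
have -> : x ^+ k.+1.*2.+1 = x * (x ^+ k.+1.*2 + y ^+ k.+1.*2 + z ^+ k.+1.*2)
    - x ^+ 1 * y ^+ k.+1.*2 - z ^+ k.+1.*2 * x ^+ 1.
  by rewrite exprS; ring.
rewrite !rpredB //; first by rewrite ideal_expMl ?steiner_power_sum.
- by apply: (steiner_edge_gt (steiner_frame_rot fr')).
- by rewrite (steiner_edge_gt fr') // addn1.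
Qed.

Lemma steiner_monomial_gt x y z a b c k : steiner_frame x y z -> (0 < k)%N ->
  (k.*2 < a + b + c)%N -> x ^+ a * y ^+ b * z ^+ c \in ideal_exp I k.
Proof.
move=> fr k0.
have fr' := steiner_frame_rot fr; have fr'' := steiner_frame_rot fr'.
have xS i j l : x ^+ i.+1 * y ^+ j * z ^+ l = x * (x ^+ i * y ^+ j * z ^+ l).
  by rewrite exprS; ring.
have yS i j l : x ^+ i * y ^+ j.+1 * z ^+ l = y * (x ^+ i * y ^+ j * z ^+ l).
  by rewrite exprS; ring.
have zS i j l : x ^+ i * y ^+ j * z ^+ l.+1 = z * (x ^+ i * y ^+ j * z ^+ l).
  by rewrite exprS; ring.
move: {-1}(a + b + c)%N (erefl (a + b + c)%N) => n.
elim: n a b c => [|n IHn] a b c abc; first by [].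
(* Above degree $2k+1$ any variable that occurs can be split off; the work is in degree exactly
   $2k+1$. *)
rewrite ltnS leq_eqVlt => /orP[/eqP kn|kn]; last first.
  case: a abc => [|a] abc; last first.
    by rewrite xS ideal_expMl // IHn //; lia.
  case: b abc => [|b] abc; last first.
    by rewrite yS ideal_expMl // IHn //; lia.
  case: c abc => [|c] abc; last first.
    by rewrite zS ideal_expMl // IHn //; lia.
  lia.
have [a0|a0] := posnP a; have [b0|b0] := posnP b; have [c0|c0] := posnP c.
- lia.
- rewrite a0 b0 !expr0 !mul1r (_ : c = k.*2.+1); last lia.
  exact: (steiner_vertex_gt fr'').
- rewrite a0 c0 !expr0 mul1r mulr1 (_ : b = k.*2.+1); last lia.
  exact: (steiner_vertex_gt fr').
- by rewrite a0 mul1r (steiner_edge_gt fr) //; lia.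
- rewrite b0 c0 !expr0 !mulr1 (_ : a = k.*2.+1); last lia.
  exact: (steiner_vertex_gt fr).
- by rewrite b0 mulr1 mulrC (steiner_edge_gt fr') //; lia.
- by rewrite c0 mulr1 (steiner_edge_gt fr'') //; lia.
(* All exponents are positive: lowering one that is at least two leaves a monomial of degree $2k$
   still divisible by $xyz$. *)
have [a1|a1] := leqP a 1; last first.
  rewrite -(prednK a0) xS ideal_expMl //.
  by rewrite (steiner_mixed fr) //; lia.
have [b1|b1] := leqP b 1; last first.
  rewrite -(prednK b0) yS ideal_expMl //.
  by rewrite (steiner_mixed fr) //; lia.
have [c1|c1] := leqP c 1; last first.
  rewrite -(prednK c0) zS ideal_expMl //.
  by rewrite (steiner_mixed fr) //; lia.
(* Only $xyz$ remains; its degree three equals $2k+1$. *)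
have -> : k = 1 by lia.
have [_ yz _ _] := fr.
have -> : b = 1 by lia.
have -> : c = 1 by lia.
by rewrite -mulrA ideal_expMl // ideal_exp1.
Qed.

End SteinerIdeal.

(** * Leading forms and linear substitutions *)

Section GradedEvaluation.
Variables (K : fieldType) (n : nat) (L : comAlgType K).
Implicit Types (e : 'I_n -> L) (p : {mpoly K[n]}).

Definition eval_alg e p : L := mmap (in_alg L) e p.

HB.instance Definition _ e := GRing.RMorphism.copy (eval_alg e)
  (mmap (in_alg L) e).

(* The coefficient of ['X^d] is the value at [e] of the degree [d] component. *)
Definition graded_eval e p : {poly L} :=
  mmap (polyC \o in_alg L) (fun i => e i *: 'X) p.

HB.instance Definition _ e := GRing.RMorphism.copy (graded_eval e)
  (mmap (polyC \o in_alg L) (fun i => e i *: 'X)).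

Lemma eval_algX e i : eval_alg e 'X_i = e i.
Proof. by rewrite /eval_alg mmapX mmap1U. Qed.

Lemma eval_algZ e c p : eval_alg e (c *: p) = c *: eval_alg e p.
Proof. by rewrite /eval_alg mmapZ mulr_algl. Qed.

Lemma graded_evalE e p : graded_eval e p =
  \sum_(m <- msupp p) (p@_m *: mmap1 e m)%:P * 'X^(mdeg m).
Proof.
apply: eq_bigr => m _; rewrite /= -[_ *: mmap1 e m]mulr_algl polyCM -mulrA;
  congr (_ * _).
rewrite /mmap1 mdegE -prodrXr rmorph_prod /= -big_split /=.
by apply: eq_bigr => i _; rewrite -mul_polyC exprMn rmorphXn.
Qed.

Lemma graded_eval_homog e d p : p \is d.-homog ->
  graded_eval e p = (eval_alg e p)%:P * 'X^d.
Proof.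
move=> /dhomogP ph; rewrite graded_evalE rmorph_sum /= mulr_suml.
rewrite !big_seq; apply: eq_bigr => m mp.
by rewrite [mdeg m](ph m mp) mulr_algl.
Qed.

(** The value does not depend on [e], which is what [same_const] requires of two such
    evaluations. *)
Lemma coef0_graded_eval e p : (graded_eval e p)`_0 = (p@_0%MM)%:A.
Proof.
rewrite graded_evalE coef_sum.
have coef0_term m : m != 0%MM ->
    ((p@_m *: mmap1 e m)%:P * 'X^(mdeg m))`_0 = 0.
  by move=> m0; rewrite coefCM coefXn eq_sym mdeg_eq0 (negPf m0) mulr0.
have [p0|p0] := boolP (0%MM \in msupp p).
  rewrite (bigD1_seq 0%MM) //= big1 // addr0.
  by rewrite coefCM coefXn mdeg0 mulr1 mmap11.
rewrite memN_msupp_eq0 // scale0r big_seq big1 // => m mp.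
by apply: coef0_term; apply: contraNneq p0 => <-.
Qed.

End GradedEvaluation.

Lemma eval_alg_vars (K : fieldType) n (p : {mpoly K[n]}) :
  eval_alg (fun i => 'X_i : {mpoly K[n]}) p = p.
Proof.
rewrite [RHS]mpolyE; apply: eq_bigr => m _.
by rewrite mmap1_id mulr_algl.
Qed.

Section LeadingForms.
Variables (A L : comNzRingType) (phi psi : {rmorphism A -> {poly L}}).

(* [p] has order at least [d] along [phi] and [psi], and its components of
   degree [d] have the same value *)
Definition same_lead d p := exists a b : {poly L},
  [/\ phi p = 'X^d * a, psi p = 'X^d * b & a`_0 = b`_0].

Lemma same_leadM d e p q :
  same_lead d p -> same_lead e q -> same_lead (d + e) (p * q).
Proof.
case=> [a [b [pa pb ab]]] [a' [b' [qa qb ab']]].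
exists (a * a'), (b * b'); rewrite !rmorphM pa pb qa qb !coef0M ab ab' exprD.
by split=> //; ring.
Qed.

Lemma same_lead_sum d I r (P : pred I) (F : I -> A) :
  (forall i, P i -> same_lead d (F i)) ->
  same_lead d (\sum_(i <- r | P i) F i).
Proof.
move=> PF; apply: big_ind => // [|p q].
  by exists 0, 0; rewrite !rmorph0 mulr0.
case=> [a [b [pa pb ab]]] [a' [b' [qa qb ab']]].
exists (a + a'), (b + b'); rewrite !rmorphD pa pb qa qb !coefD ab ab'.
by split=> //; ring.
Qed.

Hypothesis same_const : forall p, (phi p)`_0 = (psi p)`_0.

Lemma same_lead0 p : same_lead 0 p.
Proof. by exists (phi p), (psi p); rewrite !mul1r. Qed.

(** By [same_const] an arbitrary coefficient has the same lead in degree zero, so multiplying by it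
    preserves the property. *)
Lemma same_lead_ideal_gen d (X : set A) p :
  (forall g, X g -> same_lead d g) -> p \in ideal_gen X -> same_lead d p.
Proof.
move=> XP /asboolP[m [a [g [Xg ->]]]]; apply: same_lead_sum => i _.
by rewrite -[d]add0n; apply: same_leadM; [exact: same_lead0 | exact: XP].
Qed.

Lemma same_lead_ideal_exp d (I : ideal A) k p :
  (forall g, g \in I -> same_lead d g) -> p \in ideal_exp I k ->
  same_lead (d * k) p.
Proof.
move=> IP; apply: same_lead_ideal_gen => _ [g [gI ->]].
elim: k g gI => [|k IHk] g gI; first by rewrite big_ord0 muln0;
  exact: same_lead0.
rewrite big_ord_recl mulnS; apply: same_leadM; first exact: IP.
exact: IHk.
Qed.

End LeadingForms.

Section LinearForms.
Variables (K : fieldType) (n : nat).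
Implicit Types (M N : 'M[K]_n) (p : {mpoly K[n]}).

Definition linear_form M (i : 'I_n) : {mpoly K[n]} := \sum_j M i j *: 'X_j.

Definition linear_subst M p := p \mPo [tuple linear_form M i | i < n].

HB.instance Definition _ M := GRing.LRMorphism.copy (linear_subst M)
  (comp_mpoly [tuple linear_form M i | i < n]).

Lemma linear_substX M i : linear_subst M 'X_i = linear_form M i.
Proof. by rewrite /linear_subst comp_mpolyXU -tnth_nth tnth_mktuple. Qed.

Lemma linear_subst_form M N i :
  linear_subst N (linear_form M i) = linear_form (M *m N) i.
Proof.
rewrite [linear_form M i]/linear_form rmorph_sum /=; under eq_bigr => j _.
  rewrite linearZ /= linear_substX /linear_form scaler_sumr.
  under eq_bigr => l _ do rewrite scalerA.
  over.
rewrite exchange_big; apply: eq_bigr => l _.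
by rewrite -scaler_suml mxE.
Qed.

Lemma linear_form1 i : linear_form 1%:M i = 'X_i.
Proof.
rewrite /linear_form (bigD1 i) //= mxE eqxx scale1r big1 ?addr0 // => j ji.
by rewrite mxE eq_sym (negPf ji) scale0r.
Qed.

Lemma linear_substZ M c p : linear_subst M (c *: p) = c *: linear_subst M p.
Proof. exact: linearZ. Qed.

Lemma linear_substE M p : linear_subst M p =
  \sum_(m <- msupp p) p@_m *: \prod_i linear_form M i ^+ m i.
Proof.
rewrite /linear_subst comp_mpolyE; apply: eq_bigr => m _; congr (_ *: _).
by apply: eq_bigr => i _; rewrite tnth_mktuple.
Qed.

Lemma linear_substK M N : M *m N = 1%:M ->
  cancel (linear_subst M) (linear_subst N).
Proof.
move=> MN p; rewrite [linear_subst M p]linear_substE rmorph_sum /= [RHS]mpolyE.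
apply: eq_bigr => m _; rewrite linearZ rmorph_prod /= mpolyXE_id.
congr (_ *: _); apply: eq_bigr => i _.
by rewrite rmorphXn /= linear_subst_form MN linear_form1.
Qed.

Lemma linear_form_homog M i : linear_form M i \is 1.-homog.
Proof. by apply: rpred_sum => j _; rewrite rpredZ // dhomogX /= mdeg1. Qed.

Lemma homog_prodX (m : 'X_{1..n}) (F : 'I_n -> {mpoly K[n]}) :
  (forall i, F i \is 1.-homog) -> \prod_i F i ^+ m i \is (mdeg m).-homog.
Proof.
move=> F1; rewrite mdegE.
elim/big_rec2: _ => [|i d p _ ph]; first exact: dhomog1.
by rewrite dhomogM //; have := dhomogMn (m i) (F1 i); rewrite mul1n.
Qed.

Lemma linear_subst_homog M d p : p \is d.-homog -> linear_subst M p \is d.-homog.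
Proof.
move=> /dhomogP ph; rewrite linear_substE big_seq; apply: rpred_sum => m mp.
by rewrite rpredZ // -(ph m mp); apply: homog_prodX; apply: linear_form_homog.
Qed.

End LinearForms.

(* Otherwise [rmorph_sum] also matches the sum inside [mmap]. *)
Opaque linear_subst eval_alg.

(** Addition in ['I_3] is modulo three, so [r], [r + 1], [r + 1 + 1] run cyclically through the
    three coordinates. *)
Lemma ord3_rot (r : 'I_3) : r + 1 + 1 + 1 = r.
Proof. by apply/val_inj; case: r => [[|[|[|]]]]. Qed.

Lemma ord3P (r s : 'I_3) : [\/ s = r, s = r + 1 | s = r + 1 + 1].
Proof.
case: r s => [[|[|[|//]]] ?] [[|[|[|//]]] ?];
  by [apply: Or31; apply/val_inj | apply: Or32; apply/val_inj
     | apply: Or33; apply/val_inj].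
Qed.

Lemma ord3_neq (r : 'I_3) : (r + 1 == r = false) * (r + 1 + 1 == r = false)
  * (r + 1 + 1 == r + 1 = false).
Proof. by case: r => [[|[|[|]]]]. Qed.

Lemma big_ord3_rot (V : nmodType) (F : 'I_3 -> V) r :
  \sum_i F i = F r + F (r + 1) + F (r + 1 + 1).
Proof.
rewrite (bigD1 r) //= (bigD1 (r + 1)) ?ord3_neq //= (bigD1 (r + 1 + 1)) ?ord3_neq //=.
rewrite big1 ?addr0 ?addrA // => i /andP[/andP[]].
by case: (ord3P r i) => ->; rewrite eqxx ?andbF.
Qed.

Lemma prod_ord3 (A : comNzRingType) (F : 'I_3 -> A) :
  \prod_i F i = F 0 * F 1 * F (1 + 1).
Proof.
rewrite !big_ord_recl big_ord0 mulr1 mulrA.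
by congr (F _ * F _ * F _); apply/val_inj.
Qed.

Lemma mdeg_ord3 (m : 'X_{1..3}) : mdeg m = (m 0%R + m 1%R + m (1 + 1)%R)%N.
Proof.
rewrite mdegE !big_ord_recl big_ord0 addn0 addnA.
by congr (m _ + m _ + m _)%N; apply/val_inj.
Qed.

(** * Hilbert series in the diagonal coordinates *)

Lemma has_dim_fin (K : fieldType) (V : lmodType K) (W : set V) (T : finType)
    (P : pred T) (b : T -> V) :
  (forall c : T -> K, \sum_(x | P x) c x *: b x = 0 ->
     forall x, P x -> c x = 0) ->
  (forall v, W v <-> exists c : T -> K, v = \sum_(x | P x) c x *: b x) ->
  has_dim W #|P|.
Proof.
move=> free span; exists (fun i => b (enum_val i)).
have extend (c : 'I_#|P| -> K) : exists c' : T -> K,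
    (forall i, c' (enum_val i) = c i) /\
    \sum_(i < #|P|) c i *: b (enum_val i) = \sum_(x | P x) c' x *: b x.
  (* The sum has a single term when [x] is in [P] and is empty otherwise: [c] is extended by
     zero. *)
  exists (fun x => \sum_(i < #|P| | enum_val i == x) c i).
  have E i : \sum_(j < #|P| | enum_val j == enum_val i) c j = c i.
    by rewrite (eq_bigl (pred1 i)) ?big_pred1_eq // => j;
      rewrite (inj_eq enum_val_inj).
  split=> //; rewrite (big_enum_val (A := P) (fun x => _ *: b x)).
  by apply: eq_bigr => i _; rewrite E.
split=> [c c0 i|].
  have [c' [c'E sumE]] := extend c.
  by rewrite -c'E; apply: free; rewrite -?sumE //; exact: (enum_valP i).
apply/seteqP; split=> v /=.
  move=> /span[c ->]; exists (fun i => c (enum_val i)).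
  exact: (big_enum_val (A := P) (fun x => c x *: b x)).
by case=> c ->; apply/span; have [c' [_ ->]] := extend c; exists c'.
Qed.

Lemma quotient_proj_comb (K : fieldType) (A : comAlgType K) (J : ideal A) T
    (s : seq T) (c : T -> K) (F : T -> A) :
  \sum_(x <- s) c x *: quotient_proj J (F x) =
    quotient_proj J (\sum_(x <- s) c x *: F x).
Proof. by rewrite linear_sum; apply: eq_bigr => x _; rewrite linearZ. Qed.

Lemma quotient_proj_eq0 (K : fieldType) (A : comAlgType K) (J : ideal A) (p : A) :
  quotient_proj J p = 0 <-> p \in J.
Proof. by rewrite -(raddf0 (quotient_proj J)) quotient_projP subr0. Qed.

Lemma sum_delta2 (K : fieldType) (V : lmodType K) (T1 T2 : finType)
    (F : T1 -> T2 -> V) x y :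
  \sum_x' \sum_y' ((x', y') == (x, y))%:R *: F x' y' = F x y.
Proof.
rewrite (bigD1 x) //= (bigD1 y) //= eqxx scale1r big1 => [|j jy]; last first.
  by rewrite xpair_eqE (negPf jy) andbF scale0r.
rewrite addr0 big1 ?addr0 // => i ix.
by rewrite big1 // => j _; rewrite xpair_eqE (negPf ix) scale0r.
Qed.

Lemma hilbert_coef k d :
  (\sum_(0 <= i < 2 * k) 'C(i + 2, 2) *: 'X^i + (3 * k - 1)%N *: 'X^(2 * k)
     : {poly nat})`_d =
  if (d < 2 * k)%N then 'C(d + 2, 2) else if d == (2 * k)%N then (3 * k - 1)%N else 0%N.
Proof.
rewrite coefD coefZ coefXn coef_sum big_mkord.
rewrite (eq_bigr (fun i : 'I_(2 * k) => if i == d :> nat then 'C(d + 2, 2) else 0%N)); last first.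
  move=> i _; rewrite coefZ coefXn eq_sym; case: eqP => [->|_];
    last exact: mulr0.
  exact: mulr1.
rewrite -big_mkcond; have [dk|dk] := ltnP d (2 * k).
  rewrite (big_pred1 (Ordinal dk)) ?ltn_eqF //= ?mulr0 ?addr0 //.
rewrite big_pred0 => [|i]; last by rewrite ltn_eqF // (leq_trans (ltn_ord i)).
by rewrite add0r; case: eqP => _; rewrite (mulr1, mulr0).
Qed.

Section SteinerHilbertSeries.
Variables (K : fieldType) (f : 'I_4 -> dhomog 3 K 2) (M N : 'M[K]_3).
Hypothesis MN1 : M *m N = 1%:M.

Local Notation I := (forms_ideal f).
Local Notation l := (linear_form M).

Hypothesis cross_in : forall r : 'I_3, l r * l (r + 1) \in I.
Hypothesis squares_in : \sum_r l r ^+ 2 \in I.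
Hypothesis form_in_span : forall i, exists c (d : 'I_3 -> K),
  mpoly_of_dhomog (f i) =
    c *: (\sum_r l r ^+ 2) + \sum_r d r *: (l r * l (r + 1)).

Lemma linear_forms_frame r : steiner_frame I (l r) (l (r + 1)) (l (r + 1 + 1)).
Proof.
split; rewrite ?cross_in //; last by rewrite -(big_ord3_rot (fun i => l i ^+ 2)).
by rewrite -{2}(ord3_rot r) cross_in.
Qed.

Lemma linear_forms_span d p : p \is d.-homog ->
  exists s : seq 'X_{1..3}, exists c : 'X_{1..3} -> K,
    all (fun m => mdeg m == d) s /\ p = \sum_(m <- s) c m *: \prod_i l i ^+ m i.
Proof.
move=> ph; have NM1 : N *m M = 1%:M by exact: mulmx1C.
exists (msupp (linear_subst N p)), (fun m => (linear_subst N p)@_m); split.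
  by rewrite -dhomogE; apply: linear_subst_homog.
by rewrite -linear_substE (linear_substK NM1).
Qed.

(** * Independence: values on the coordinate lines *)

Section FrameEval.
Variables (L : comAlgType K) (e : 'I_3 -> L).

(** Evaluation at the point where the forms [l i] take the values [e i], since [linear_subst N]
    sends [l i] to ['X_i]. *)
Definition frame_eval p : L := eval_alg e (linear_subst N p).

Lemma frame_evalD p q : frame_eval (p + q) = frame_eval p + frame_eval q.
Proof. by rewrite /frame_eval !rmorphD. Qed.

Lemma frame_eval_sum T (F : T -> {mpoly K[3]}) (s : seq T) :
  frame_eval (\sum_(x <- s) F x) = \sum_(x <- s) frame_eval (F x).
Proof.
elim: s => [|x s IHs]; first by rewrite !big_nil /frame_eval !rmorph0.
by rewrite !big_cons frame_evalD IHs.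
Qed.

Lemma frame_evalZ c p : frame_eval (c *: p) = c *: frame_eval p.
Proof. by rewrite /frame_eval linear_substZ eval_algZ. Qed.

Lemma frame_evalMX i j a b :
  frame_eval (l i ^+ a * l j ^+ b) = e i ^+ a * e j ^+ b.
Proof.
rewrite /frame_eval !(rmorphM, rmorphXn) /= !linear_subst_form MN1.
by rewrite !linear_form1 !eval_algX.
Qed.

Lemma frame_eval_lead d p : p \is d.-homog ->
  graded_eval e (linear_subst N p) = (frame_eval p)%:P * 'X^d.
Proof. by move=> ph; apply: graded_eval_homog; apply: linear_subst_homog. Qed.

End FrameEval.
Opaque frame_eval.

(** The generators agree at [e] and [e'], so elements of the ideal share their lead in degree 2, and
    those of its [k]-th power in degree [2 * k]. Below that degree all components vanish at both
    points. *)
Lemma ideal_exp_lead (L : comAlgType K) (e e' : 'I_3 -> L) k p d :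
  (forall i, frame_eval e (f i) = frame_eval e' (f i)) ->
  p \in ideal_exp I k -> p \is d.-homog -> (d <= 2 * k)%N ->
  frame_eval e p = if d == (2 * k)%N then frame_eval e' p else 0.
Proof.
move=> ee pI ph dk.
have [] := @same_lead_ideal_exp {mpoly K[3]} L
    (graded_eval e \o linear_subst N) (graded_eval e' \o linear_subst N)
    _ 2 _ k p _ pI.
- by move=> q; rewrite /= !coef0_graded_eval.
- move=> g; apply: same_lead_ideal_gen.
    by move=> q; rewrite /= !coef0_graded_eval.
  move=> _ [i _ <-]; rewrite /same_lead /= !(frame_eval_lead _ (dhomog_is_dhomog (f i))) ee.
  set a := (frame_eval _ _)%:P; exists a, a.
  by rewrite ![_ * a]mulrC.
move=> a [b [/= ea eb ab]].
move: ea eb; rewrite !(frame_eval_lead _ ph).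
move=> /(congr1 (coefp d)) ea /(congr1 (coefp d)) eb; move: ea eb.
rewrite /= !coefMXn !coefXnM !ltnn !subnn !coefC eqxx => -> ->.
move: dk; rewrite leq_eqVlt; case: eqP => [->|_] /=;
  first by rewrite ltnn subnn.
by move=> ->.
Qed.

(** Take for both points the generic one, whose coordinates are the variables: a form vanishing
    there is zero. *)
Lemma ideal_exp_order k p d :
  p \in ideal_exp I k -> p \is d.-homog -> (d < 2 * k)%N -> p = 0.
Proof.
move=> pI ph dk.
have := @ideal_exp_lead {mpoly K[3]} (fun i => 'X_i) (fun i => 'X_i) k p d
  (fun=> erefl) pI ph (ltnW dk).
rewrite (ltn_eqF dk); rewrite -[frame_eval _ p]/(eval_alg _ _) eval_alg_vars => p0.
have NM1 : N *m M = 1%:M by exact: mulmx1C.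
by rewrite -[p](linear_substK NM1) p0 rmorph0.
Qed.

(** Parametrizes the coordinate line on which the third form [l (r + 1 + 1)] vanishes. *)
Definition edge_point (L : comAlgType K) (s t : L) (r i : 'I_3) : L :=
  if i == r then s else if i == r + 1 then t else 0.

Lemma edge_pointE (L : comAlgType K) (s t : L) (r : 'I_3) :
  [/\ edge_point s t r r = s, edge_point s t r (r + 1) = t
    & edge_point s t r (r + 1 + 1) = 0].
Proof. by rewrite /edge_point !eqxx !ord3_neq. Qed.

(** On this line a generator restricts to a combination of $s^2+t^2$ and $st$. *)
Lemma form_edge_sym (L : comAlgType K) (s t : L) r i :
  frame_eval (edge_point s t r) (f i) = frame_eval (edge_point t s r) (f i).
Proof.
have [c [d ->]] := form_in_span i.
have square (e : 'I_3 -> L) j : frame_eval e (l j ^+ 2) = e j ^+ 2.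
  by have := frame_evalMX e j j 2 0; rewrite !mulr1.
have cross (e : 'I_3 -> L) j j' : frame_eval e (l j * l j') = e j * e j'.
  exact: frame_evalMX e j j' 1 1.
rewrite !(big_ord3_rot _ r) ord3_rot !(frame_evalD, frame_evalZ) !square !cross.
have [-> -> ->] := edge_pointE s t r; have [-> -> ->] := edge_pointE t s r.
by rewrite !(mulr0, mul0r, expr0n, addr0) /= (addrC (t ^+ 2)) (mulrC t).
Qed.

(** Used for $j<k$: $j=0$ gives a vertex power and $0<j<k$ the half of an edge nearer to the vertex
    [r]. Modulo the [k]-th power the other half is opposite to these and the midpoint vanishes. *)
Definition edge_monomial k r j := l r ^+ (2 * k - j) * l (r + 1) ^+ j.

Lemma edge_monomial_homog k r j : (j <= 2 * k)%N ->
  edge_monomial k r j \is (2 * k).-homog.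
Proof.
move=> jk; have := dhomogM (dhomogMn (2 * k - j) (linear_form_homog M r))
  (dhomogMn j (linear_form_homog M (r + 1))).
by rewrite !mul1n subnK.
Qed.

Lemma edge_comb_homog k (c : 'I_3 -> 'I_k -> K) :
  \sum_r \sum_j c r j *: edge_monomial k r j \is (2 * k).-homog.
Proof.
do 2!apply: rpred_sum => ? _; rewrite rpredZ // edge_monomial_homog //.
by rewrite ltnW // (leq_trans (ltn_ord _)) // leq_pmull.
Qed.

Lemma edge_comb_eval k (c : 'I_3 -> 'I_k.+1 -> K) (s t : {poly K}) r :
  frame_eval (edge_point s t r)
    (\sum_r \sum_j c r j *: edge_monomial k.+1 r j) =
  \sum_(j < k.+1) c r j *: (s ^+ (2 * k.+1 - j) * t ^+ j)
    + c (r + 1) ord0 *: t ^+ (2 * k.+1).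
Proof.
have [es et e0] := edge_pointE s t r.
pose e := edge_point s t r.
transitivity (\sum_r \sum_(j < k.+1)
    c r j *: (e r ^+ (2 * k.+1 - j) * e (r + 1) ^+ j)).
  rewrite frame_eval_sum; apply: eq_bigr => q _; rewrite frame_eval_sum.
  by apply: eq_bigr => j _; rewrite frame_evalZ frame_evalMX.
(* The monomials of edge [r] survive, those of the third edge all contain the vanishing coordinate,
   and edge [r + 1] contributes only its vertex power. *)
rewrite (big_ord3_rot _ r) /e ord3_rot es et e0 -[LHS]addrA; congr (_ + _).
rewrite [X in _ + X]big1 ?addr0 => [|j _]; last first.
  rewrite expr0n subn_eq0.
  have -> : (2 * k.+1 <= j)%N = false by have := ltn_ord j; lia.
  by rewrite mul0r scaler0.
rewrite big_ord_recl big1 ?addr0 => [|j _]; first by rewrite subn0 mulr1.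
by rewrite expr0n mulr0 scaler0.
Qed.

(** Compare the coefficients of $X^j$ at the parameters $(1,X)$ and $(X,1)$. After the swap the edge
    terms have degree above [k], and only the vertex power of [r + 1] reaches degree zero. *)
Lemma edge_comb_in k (c : 'I_3 -> 'I_k.+1 -> K) :
  \sum_r \sum_j c r j *: edge_monomial k.+1 r j \in ideal_exp I k.+1 ->
  forall r j, c r j = if j == ord0 then c (r + 1) ord0 else 0.
Proof.
move=> cI r j.
have := ideal_exp_lead (form_edge_sym 1 'X r) cI (edge_comb_homog _) (leqnn _).
rewrite eqxx !edge_comb_eval => /(congr1 (coefp j)) /=.
have jk := ltn_ord j.
rewrite !coefD !coef_sum !coefZ coefXn expr1n coef1.
rewrite (bigD1 j) //= coefZ expr1n mul1r coefXn eqxx mulr1.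
rewrite big1 ?addr0 => [|i ij]; last first.
  by rewrite coefZ expr1n mul1r coefXn eq_sym (inj_eq val_inj) (negPf ij) mulr0.
rewrite big1 ?add0r => [|i _]; last first.
  rewrite coefZ expr1n mulr1 coefXn.
  have -> : (j == (2 * k.+1 - i)%N :> nat) = false by have := ltn_ord i; lia.
  by rewrite mulr0.
have -> : (j == (2 * k.+1)%N :> nat) = false by lia.
rewrite mulr0 addr0 => ->; rewrite -[j == ord0]/(j == 0 :> nat).
by case: eqP; rewrite (mulr0, mulr1).
Qed.

(** One vertex power is left out because the three of them sum to zero in the quotient. *)
Definition edge_basis k : pred ('I_3 * 'I_k.+1) :=
  [pred x | x != (1 + 1, ord0)].
Arguments edge_basis : clear implicits.

Lemma card_edge_basis k : #|edge_basis k| = (3 * k.+1 - 1)%N.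
Proof. by rewrite cardC1 card_prod !card_ord subn1. Qed.

Lemma edge_comb_in_eq0 k (c : 'I_3 -> 'I_k.+1 -> K) : c (1 + 1) ord0 = 0 ->
  \sum_r \sum_j c r j *: edge_monomial k.+1 r j \in ideal_exp I k.+1 ->
  forall r j, c r j = 0.
Proof.
move=> c0 /edge_comb_in cE.
have c1 : c 1 ord0 = 0 by rewrite cE eqxx.
have c00 : c 0 ord0 = 0 by rewrite cE eqxx add0r.
move=> r j; have [->|j0] := eqVneq j ord0; last by rewrite cE (negPf j0).
by case: (ord3P 0 r) => ->; rewrite ?add0r.
Qed.

(** * Spanning by the edge monomials *)

Section Spanning.
Variable k : nat.

(** The condition on [c] restricts to [edge_basis] while keeping a full double sum. *)
Definition edge_spanned (p : {mpoly K[3]}) :=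
  exists2 c : 'I_3 -> 'I_k.+1 -> K, c (1 + 1) ord0 = 0 &
    p - \sum_r \sum_j c r j *: edge_monomial k.+1 r j \in ideal_exp I k.+1.

Lemma edge_spannedD p q :
  edge_spanned p -> edge_spanned q -> edge_spanned (p + q).
Proof.
case=> [c c0 cp] [d d0 dq]; exists (fun r j => c r j + d r j).
  by rewrite c0 d0 addr0.
have -> : p + q - \sum_r \sum_j (c r j + d r j) *: edge_monomial k.+1 r j
  = (p - \sum_r \sum_j c r j *: edge_monomial k.+1 r j)
  + (q - \sum_r \sum_j d r j *: edge_monomial k.+1 r j).
  rewrite addrACA -opprD -big_split; congr (_ - _).
  apply: eq_bigr => r _; rewrite -big_split; apply: eq_bigr => j _.
  by rewrite scalerDl.
exact: rpredD.
Qed.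

Lemma edge_spannedZ a p : edge_spanned p -> edge_spanned (a *: p).
Proof.
case=> [c c0 cp]; exists (fun r j => a * c r j); first by rewrite c0 mulr0.
have -> : \sum_r \sum_j (a * c r j) *: edge_monomial k.+1 r j
  = a *: (\sum_r \sum_j c r j *: edge_monomial k.+1 r j).
  rewrite scaler_sumr; apply: eq_bigr => r _.
  by rewrite scaler_sumr; apply: eq_bigr => j _; rewrite scalerA.
by rewrite -scalerBr -mulr_algl ideal_expMl.
Qed.

Lemma edge_spanned_in p : p \in ideal_exp I k.+1 -> edge_spanned p.
Proof.
move=> pI; exists (fun _ _ => 0) => //.
by rewrite big1 ?subr0 // => r _; rewrite big1 // => j _; rewrite scale0r.
Qed.

Lemma edge_spannedN p : edge_spanned p -> edge_spanned (- p).
Proof. by rewrite -scaleN1r; exact: edge_spannedZ. Qed.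

Lemma edge_spanned_mod p q :
  p - q \in ideal_exp I k.+1 -> edge_spanned q -> edge_spanned p.
Proof. by move=> /edge_spanned_in pq /(edge_spannedD pq); rewrite subrK. Qed.

Lemma edge_spanned_basis r (j : 'I_k.+1) : edge_basis k (r, j) ->
  edge_spanned (edge_monomial k.+1 r j).
Proof.
move=> rj; exists (fun r' j' => ((r', j') == (r, j))%:R).
  by move: rj; rewrite /edge_basis /= eq_sym => /negPf ->.
by rewrite sum_delta2 subrr rpred0.
Qed.

Lemma edge_spanned_vertex r : edge_spanned (l r ^+ (2 * k.+1)).
Proof.
have basis s : s != 1 + 1 -> edge_spanned (l s ^+ (2 * k.+1)).
  move=> s2; have -> : l s ^+ (2 * k.+1) = edge_monomial k.+1 s (@ord0 k).
    by rewrite /edge_monomial subn0 mulr1.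
  by apply: edge_spanned_basis; rewrite /edge_basis /= xpair_eqE (negPf s2).
have [->|] := eqVneq r (1 + 1); last exact: basis.
apply: (@edge_spanned_mod _ (- l 0 ^+ (2 * k.+1) - l 1 ^+ (2 * k.+1)));
  last first.
  by apply: edge_spannedD; apply: edge_spannedN; apply: basis.
have := steiner_power_sum k (linear_forms_frame 0).
rewrite add0r -mul2n; move: (2 * k.+1)%N => n.
by rewrite opprD !opprK addrC.
Qed.

(** For [c] below [k.+1] this is a basis monomial, at [k.+1] it is a power of the generator product,
    and beyond it [steiner_edge] swaps the exponents up to sign. *)
Lemma edge_spanned_edge r b c : (0 < b)%N -> (0 < c)%N -> (b + c = 2 * k.+1)%N ->
  edge_spanned (l r ^+ b * l (r + 1) ^+ c).
Proof.
move=> b0 c0 bc; have fr := steiner_frame_rot (steiner_frame_rot (linear_forms_frame r)).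
have basis a d : (0 < d)%N -> (d < k.+1)%N -> (a + d = 2 * k.+1)%N ->
    edge_spanned (l r ^+ a * l (r + 1) ^+ d).
  move=> d0 dk ad; have -> : a = (2 * k.+1 - d)%N by lia.
  apply: (@edge_spanned_basis r (Ordinal dk)).
  by rewrite /edge_basis /= xpair_eqE -(inj_eq val_inj (Ordinal dk)) /= (gtn_eqF d0) andbF.
have [ck|] := ltnP c k.+1; first exact: basis.
rewrite leq_eqVlt => /orP[/eqP ck|ck].
  have -> : b = k.+1 by lia.
  by rewrite -ck -exprMn; apply: edge_spanned_in; rewrite ideal_expX.
apply: (@edge_spanned_mod _ (- (l r ^+ c * l (r + 1) ^+ b))); last first.
  by apply: edge_spannedN; apply: (basis c b b0); lia.
have := steiner_edge b.-1 (k.+1 - b) fr; rewrite prednK // subnKC; last lia.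
have -> : c = (b + (k.+1 - b).*2)%N by lia.
have -> : (l r * l (r + 1)) ^+ b * (l r ^+ (k.+1 - b).*2 + l (r + 1) ^+ (k.+1 - b).*2)
  = l r ^+ (b + (k.+1 - b).*2) * l (r + 1) ^+ b
    - - (l r ^+ b * l (r + 1) ^+ (b + (k.+1 - b).*2)) by rewrite exprMn !exprD;
      ring.
by rewrite !opprK addrC.
Qed.

Lemma edge_spanned_homog p : p \is (2 * k.+1).-homog -> edge_spanned p.
Proof.
move=> /linear_forms_span[s [c [/allP sd ->]]]; rewrite big_seq.
apply: big_ind => [||m ms].
- by apply: edge_spanned_in; rewrite rpred0.
- exact: edge_spannedD.
apply: edge_spannedZ; move/eqP: (sd m ms); rewrite mdeg_ord3 prod_ord3 => md.
have e2 := @edge_spanned_edge (1 + 1); have e0 := ord3_rot 0.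
rewrite add0r in e0; rewrite e0 in e2.
have [a0|a0] := posnP (m 0); have [b0|b0] := posnP (m 1);
  have [d0|d0] := posnP (m (1 + 1)).
- lia.
- rewrite a0 b0 !expr0 !mul1r (_ : m (1 + 1) = (2 * k.+1)%N); last lia.
  exact: edge_spanned_vertex.
- rewrite a0 d0 !expr0 mul1r mulr1 (_ : m 1 = (2 * k.+1)%N); last lia.
  exact: edge_spanned_vertex.
- by rewrite a0 mul1r; apply: edge_spanned_edge => //; lia.
- rewrite b0 d0 !expr0 !mulr1 (_ : m 0 = (2 * k.+1)%N); last lia.
  exact: edge_spanned_vertex.
- by rewrite b0 mulr1 mulrC; apply: e2 => //; lia.
- rewrite d0 mulr1; have := @edge_spanned_edge 0; rewrite add0r.
  by apply => //; lia.
apply: edge_spanned_in; have := linear_forms_frame 0; rewrite add0r => fr.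
by rewrite (steiner_mixed fr) //; lia.
Qed.

End Spanning.

(** By [ideal_exp_order] the projection is injective on forms of degree [d], so a basis of forms
    stays a basis. *)
Lemma graded_piece_low k d : (d < 2 * k)%N ->
  has_dim (graded_piece (ideal_exp I k) d) 'C(d + 2, 2).
Proof.
move=> dk; have -> : 'C(d + 2, 2) = \dim {:dhomog 3 K d}.
  by rewrite dimvf /= -bin_sub ?leq_addl // addnK.
set X := vbasis {:dhomog 3 K d}.
have Xbasis : basis_of {:dhomog 3 K d} X by exact: vbasisP.
exists (fun i => quotient_proj (ideal_exp I k) (mpoly_of_dhomog X`_i)).
have comb (c : 'I_(\dim {:dhomog 3 K d}) -> K) :
    \sum_i c i *: quotient_proj (ideal_exp I k) (mpoly_of_dhomog X`_i)
    = quotient_proj (ideal_exp I k) (mpoly_of_dhomog (\sum_i c i *: X`_i)).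
  rewrite quotient_proj_comb; congr quotient_proj.
  by rewrite (linear_sum (@mpoly_of_dhomog 3 K d)).
split=> [c|].
  rewrite comb => /quotient_proj_eq0 cI.
  have /val_inj X0 : val (\sum_i c i *: X`_i) = val (0 : dhomog 3 K d).
    exact: (ideal_exp_order cI (dhomog_is_dhomog _) dk).
  by move=> i; apply: (freeP (basis_free Xbasis) c X0).
apply/seteqP; split=> v /=.
  case=> p ph <-; exists (fun i => coord X i (DHomog ph)).
  by rewrite comb -(coord_basis Xbasis) ?memvf.
case=> c ->; rewrite comb; exists (\sum_i c i *: X`_i) => //.
exact: dhomog_is_dhomog.
Qed.

Lemma graded_piece_top k :
  has_dim (graded_piece (ideal_exp I k.+1) (2 * k.+1)) (3 * k.+1 - 1).
Proof.
rewrite -card_edge_basis.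
pose extend (c : 'I_3 * 'I_k.+1 -> K) r j : K :=
  if edge_basis k (r, j) then c (r, j) else 0.
have extend0 c : extend c (1 + 1) ord0 = 0.
  by rewrite /extend (_ : edge_basis k _ = false) //; apply/negbF/eqP.
have comb c : \sum_(x | edge_basis k x)
      c x *: quotient_proj (ideal_exp I k.+1) (edge_monomial k.+1 x.1 x.2)
    = quotient_proj (ideal_exp I k.+1)
        (\sum_r \sum_j extend c r j *: edge_monomial k.+1 r j).
  rewrite pair_bigA -quotient_proj_comb big_mkcond.
  by apply: eq_bigr => -[r j] _; rewrite /extend; case: ifP => // _;
    rewrite scale0r.
apply: (@has_dim_fin _ _ _ _ (edge_basis k) (fun x =>
  quotient_proj (ideal_exp I k.+1) (edge_monomial k.+1 x.1 x.2))) => [c|v].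
  rewrite comb => /quotient_proj_eq0.
  move=> /(edge_comb_in_eq0 (extend0 c)) c0 [r j] rj.
  by rewrite -(c0 r j) /extend rj.
split=> [[p /= /edge_spanned_homog[c c0 pc] <-]|[c ->]].
  exists (fun x => c x.1 x.2); rewrite comb.
  suff -> : \sum_r \sum_j extend (fun x => c x.1 x.2) r j *: edge_monomial k.+1 r j
      = \sum_r \sum_j c r j *: edge_monomial k.+1 r j by apply/quotient_projP.
  apply: eq_bigr => r _; apply: eq_bigr => j _; rewrite /extend /edge_basis /=.
  by case: eqP => // -[-> ->]; rewrite c0.
by rewrite comb; eexists; last reflexivity; exact: edge_comb_homog.
Qed.

Lemma graded_piece_high k d : (0 < k)%N -> (2 * k < d)%N ->
  has_dim (graded_piece (ideal_exp I k) d) 0.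
Proof.
move=> k0 kd; exists (fun=> 0); split=> [c _ []//|].
apply/seteqP; split=> v /= [p] => [ph <-|->]; last first.
  by exists 0; rewrite ?raddf0 ?big_ord0 //; exact: rpred0.
exists (fun=> 0); rewrite big_ord0; apply/quotient_proj_eq0.
have [s [c [/allP sd ->]]] := linear_forms_span ph.
rewrite big_seq; apply: rpred_sum => m ms; rewrite -mulr_algl ideal_expMl //.
move/eqP: (sd m ms); rewrite mdeg_ord3 prod_ord3 => md;
  have := linear_forms_frame 0; rewrite add0r => fr.
by rewrite (steiner_monomial_gt fr) // -mul2n md.
Qed.

Lemma steiner_hilbert_series k : (0 < k)%N ->
  is_hilbert_series (graded_piece (ideal_exp I k))
    (fun d => (\sum_(0 <= i < 2 * k) 'C(i + 2, 2) *: 'X^i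
                 + (3 * k - 1)%N *: 'X^(2 * k) : {poly nat})`_d).
Proof.
move=> k0 d; rewrite hilbert_coef; case: ltngtP => [dk|dk|->].
- exact: graded_piece_low.
- exact: graded_piece_high.
by case: k k0 => // k _; exact: graded_piece_top.
Qed.

End SteinerHilbertSeries.

(** * Simultaneous diagonalization of a pencil *)

Section CubicDiscriminant.
Variable S : comNzRingType.

(** The discriminant of the monic cubic $X^3+aX^2+bX+c$. *)
Definition cubic_disc (p : {poly S}) : S :=
  let a := p`_2 in let b := p`_1 in let c := p`_0 in
  a ^+ 2 * b ^+ 2 - 4 * b ^+ 3 - 4 * a ^+ 3 * c + 18 * a * b * c - 27 * c ^+ 2.

Lemma cubic_disc_roots (r s t : S) :
  cubic_disc (('X - r%:P) * ('X - s%:P) * ('X - t%:P))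
    = ((r - s) * (s - t) * (t - r)) ^+ 2.
Proof.
have -> : ('X - r%:P) * ('X - s%:P) * ('X - t%:P) = 'X^3 - (r + s + t)%:P * 'X^2
    + (r * s + s * t + t * r)%:P * 'X^1 - (r * s * t)%:P * 'X^0.
  by rewrite !(polyCD, polyCM); ring.
rewrite /cubic_disc !(coefD, coefB, coefN, coefCM, coefXn) /=; ring.
Qed.

End CubicDiscriminant.

Lemma cubic_disc_map (S T : comNzRingType) (h : {rmorphism S -> T}) p :
  cubic_disc (map_poly h p) = h (cubic_disc p).
Proof.
rewrite /cubic_disc !coef_map /=.
by rewrite !(rmorph_nat, rmorphXn, rmorphD, rmorphN, rmorphM).
Qed.

Lemma char_poly_simmx (F : fieldType) n (P A B : 'M[F]_n) :
  P \in unitmx -> P *m A = B *m P -> char_poly A = char_poly B.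
Proof.
move=> Pu PA; have detP : \det (map_mx polyC P) != 0.
  by rewrite det_map_mx polyC_eq0 -unitfE -unitmxE.
apply: (mulfI detP); rewrite mulrC -!det_mulmx.
suff: map_mx polyC P *m char_poly_mx A = char_poly_mx B *m map_mx polyC P.
  by move=> /(congr1 determinant); rewrite !det_mulmx mulrC => ->;
    rewrite mulrC.
rewrite /char_poly_mx mulmxBr mulmxBl -!map_mxM PA; congr (_ - _).
by rewrite mul_mx_scalar mul_scalar_mx.
Qed.

(** A nonzero discriminant makes the eigenvalues distinct, so the minimal polynomial splits into
    distinct linear factors. The discriminant, read again on the diagonal form, separates the
    entries of [d]. *)
Lemma diagonalizable_cubic_disc (F : closedFieldType) (A : 'M[F]_3) :
  cubic_disc (char_poly A) != 0 -> exists P d,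
    [/\ P \in unitmx, P *m A = diag_mx d *m P
      & (d 0 0 - d 0 1) * (d 0 1 - d 0 (1 + 1)) * (d 0 (1 + 1) - d 0 0) != 0].
Proof.
move=> disc; have [rs rsE] := closed_field_poly_normal (char_poly A).
have Amonic := char_poly_monic A; rewrite (monicP Amonic) scale1r in rsE.
have srs : size rs = 3.
  by have := size_char_poly A; rewrite rsE size_prod_XsubC => -[].
have urs : uniq rs.
  move: srs rsE disc; case: rs => [|r [|s [|t [|]]]] // _ ->.
  rewrite !big_cons big_nil mulr1 mulrA cubic_disc_roots /=.
  rewrite !inE !negb_or andbT expf_eq0 /= !mulf_eq0 !subr_eq0 !negb_or.
  by rewrite (eq_sym t) andbAC.
have [P Pu /diagonalizable_forPex[d /(simmxP Pu) PA]] : diagonalizable A.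
  by apply/diagonalizableP; exists rs; rewrite // -rsE mxminpoly_dvd_char.
exists P, d; split=> //; move: disc; rewrite (char_poly_simmx Pu PA).
rewrite char_poly_trig ?diag_mx_is_trig // prod_ord3.
by rewrite cubic_disc_roots expf_eq0 /= !mxE !eqxx !mulr1n.
Qed.

Section PencilFrame.
Variables (F : numClosedFieldType) (A B : 'M[F]_3).
Hypotheses (Asym : A^T = A) (Bsym : B^T = B) (Au : \det A != 0).

(** The adjugate replaces the inverse to stay polynomial in the entries, at the price of the factor
    [\det A]. *)
Lemma pencil_eigenbasis : cubic_disc (char_poly (B *m \adj A)) != 0 ->
  exists P d, [/\ P \in unitmx, \det A *: (P *m B *m P^T) = diag_mx d *m (P *m A *m P^T)
    & (d 0 0 - d 0 1) * (d 0 1 - d 0 (1 + 1)) * (d 0 (1 + 1) - d 0 0) != 0].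
Proof.
move=> /diagonalizable_cubic_disc[P [d [Pu PM dd]]]; exists P, d; split=> //.
have -> : \det A *: (P *m B *m P^T) = P *m (B *m \adj A) *m A *m P^T.
  rewrite mulmxA -(mulmxA (P *m B)) mul_adj_mx.
  by rewrite mul_mx_scalar -scalemxAl.
by rewrite PM !mulmxA.
Qed.

(* The rows of an eigenbasis are rescaled so that both traces vanish, that is so
   that the sum of squares of the new linear forms is apolar to the pencil. *)
Lemma pencil_frame : cubic_disc (char_poly (B *m \adj A)) != 0 ->
  exists P : 'M[F]_3, exists a b : 'I_3 -> F,
  [/\ P \in unitmx, P *m A *m P^T = diag_mx (\row_i a i),
      P *m B *m P^T = diag_mx (\row_i b i), \sum_i a i = 0 /\ \sum_i b i = 0
    & a 0 * b 1 - a 1 * b 0 != 0].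
Proof.
move=> /pencil_eigenbasis[P [d [Pu PBE dd]]].
set G := P *m A *m P^T in PBE.
have Gsym : G^T = G by rewrite /G !trmx_mul trmxK Asym mulmxA.
have PBsym : (P *m B *m P^T)^T = P *m B *m P^T by rewrite !trmx_mul trmxK Bsym mulmxA.
have entry i j : \det A * (P *m B *m P^T) i j = d 0 i * G i j.
  by have /matrixP/(_ i j) := PBE; rewrite mul_diag_mx !mxE.
have d_inj i j : i != j -> d 0 i != d 0 j.
  move: dd; rewrite !mulf_eq0 !subr_eq0 !negb_or -andbA => /and3P[d01 d12 d20].
  by case: (ord3P 0 i) => ->; case: (ord3P 0 j) => ->;
    rewrite ?add0r ?eqxx // => _; rewrite // eq_sym.
(* Eigenvectors of distinct eigenvalues are orthogonal for [G], as both forms are symmetric. *)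
have Goff i j : i != j -> G i j = 0.
  move=> /d_inj ij; have /eqP : (d 0 i - d 0 j) * G i j = 0.
    have Gji : G i j = G j i by rewrite -[in LHS]Gsym mxE.
    have Bji : (P *m B *m P^T) j i = (P *m B *m P^T) i j by rewrite -[in LHS]PBsym mxE.
    by rewrite mulrBl -entry Gji -entry Bji subrr.
  by rewrite mulf_eq0 subr_eq0 (negPf ij) => /eqP.
have Gdiag : G = diag_mx (\row_i G i i).
  apply/matrixP => i j; rewrite [RHS]mxE [(\row__ _) _ _]mxE.
  have [->|ij] := eqVneq i j; first by rewrite mulr1n.
  by rewrite mulr0n Goff.
have Gii i : G i i != 0.
  have : \det (diag_mx (\row_i G i i)) != 0.
    by rewrite -Gdiag /G !det_mulmx det_tr !mulf_neq0 // -unitfE -unitmxE.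
  by rewrite det_diag => /prodf_neq0/(_ i isT); rewrite mxE.
(* Cyclic differences of the eigenvalues sum to zero, and so do their products with the [d 0 i];
   square roots then rescale the diagonal of [G] to [a]. *)
pose a i := d 0 (i + 1) - d 0 (i + 1 + 1).
pose D := diag_mx (\row_i sqrtC (a i / G i i)).
have DE (H : 'M_3) i j : (D *m H *m D^T) i j =
    sqrtC (a i / G i i) * sqrtC (a j / G j j) * H i j.
  by rewrite tr_diag_mx mul_mx_diag mul_diag_mx !mxE; ring.
have DGE i : (D *m G *m D^T) i i = a i.
  by rewrite DE -expr2 sqrtCK mulfVK.
have off (H : 'M_3) : (forall i j, i != j -> H i j = 0) ->
    D *m H *m D^T = diag_mx (\row_i (D *m H *m D^T) i i).
  move=> H0; apply/matrixP => i j; have [->|ij] := eqVneq i j.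
    by rewrite [RHS]mxE [(\row__ _) _ _]mxE eqxx mulr1n.
  by rewrite DE H0 // mulr0 mxE (negPf ij) mulr0n.
exists (D *m P), a, (fun i => d 0 i * a i / \det A).
have conj (H : 'M[F]_3) : D *m P *m H *m (D *m P)^T = D *m (P *m H *m P^T) *m D^T.
  by rewrite trmx_mul !mulmxA.
split.
- rewrite unitmx_mul Pu andbT unitmxE det_diag unitfE; apply/prodf_neq0 => i _.
  rewrite mxE sqrtC_eq0 mulf_eq0 invr_eq0 (negPf (Gii i)) orbF subr_eq0.
  by apply: d_inj; rewrite eq_sym ord3_neq.
- by rewrite conj -/G off //; congr diag_mx; apply/rowP => i;
  rewrite [LHS]mxE DGE mxE.
- rewrite conj off => [|i j ij]; last first.
    by apply: (mulfI Au); rewrite entry Goff // !mulr0.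
  congr diag_mx; apply/rowP => i; rewrite [LHS]mxE [RHS]mxE -(DGE i) !DE.
  by apply: (mulfI Au); rewrite mulrCA entry; field.
- by split; rewrite (big_ord3_rot _ 0) /a !ord3_rot !add0r; field.
rewrite /a (_ : 1 + 1 + 1 = 0 :> 'I_3); last exact/val_inj.
rewrite add0r; set x := d 0 0 in dd *; set y := d 0 1 in dd *.
set z := d 0 (1 + 1) in dd *.
have -> : (y - z) * (y * (z - x) / \det A) - (z - x) * (x * (y - z) / \det A)
  = - ((x - y) * (y - z) * (z - x)) / \det A by ring.
by rewrite mulf_neq0 ?oppr_eq0 ?invr_eq0.
Qed.

End PencilFrame.

(** * The dual pencil of four quadrics *)

Definition quad_mon (i j : 'I_3) : 'X_{1..3} := (U_(i) + U_(j))%MM.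

(** The chart monomials are $xy$, $yz$, $zx$, $z^2$; the two left over, $x^2$ and $y^2$, index the
    dual pencil. *)
Definition chart_pair (t : 'I_4) : 'I_3 * 'I_3 :=
  match val t with
  | 0 => (0, 1) | 1 => (1, 1 + 1) | 2 => (1 + 1, 0) | _ => (1 + 1, 1 + 1)
  end.

Definition chart_mon t := quad_mon (chart_pair t).1 (chart_pair t).2.

Section Resolvent.
Variables (S : comNzRingType) (c : 'I_4 -> 'X_{1..3} -> S).

(* [c i m] is the coefficient of the monomial [m] in the [i]-th quadric. *)
Definition chart_mx : 'M[S]_4 := \matrix_(i, t) c i (chart_mon t).

(* By Cramer's rule this is, up to the factor [\det chart_mx], the coefficient
   of [m] left in the quadric [u] once a combination of the quadrics [c i] has
   cancelled its coefficients on the chart monomials. *)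
Definition dual_form (m : 'X_{1..3}) (u : 'X_{1..3} -> S) : S :=
  \det chart_mx * u m
    - ((\row_t u (chart_mon t)) *m \adj chart_mx *m (\col_i c i m)) 0 0.

Lemma eq_dual_form m u v : u =1 v -> dual_form m u = dual_form m v.
Proof.
move=> uv; rewrite /dual_form uv; congr (_ - (_ *m _ *m _) 0 0).
by apply/rowP => t; rewrite !mxE.
Qed.

(** The symmetric matrix of the functional [dual_form m]: its entries are the values on the products
    of two variables. *)
Definition gram m : 'M[S]_3 :=
  \matrix_(i, j) dual_form m (fun m' => (quad_mon i j == m')%:R).

Definition gram0 := gram (quad_mon 0 0) + gram (quad_mon 1 1).
Definition gram1 := gram (quad_mon 1 1).

Lemma gram_sym m : (gram m)^T = gram m.
Proof. by apply/matrixP => i j; rewrite !mxE /quad_mon addmC. Qed.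

Lemma gram0_sym : gram0^T = gram0.
Proof.
transitivity ((gram (quad_mon 0 0))^T + (gram (quad_mon 1 1))^T);
  first exact: raddfD.
by congr (_ + _); exact: gram_sym.
Qed.

(** The factors say in turn that the quadrics can be solved for the chart monomials, that the first
    member of the dual pencil is nondegenerate, and that the pencil has distinct eigenvalues. *)
Definition resolvent : S :=
  \det chart_mx * \det gram0 * cubic_disc (char_poly (gram1 *m \adj gram0)).

End Resolvent.

Section ResolventMap.
Variables (S T : comNzRingType) (h : {rmorphism S -> T}).
Variable c : 'I_4 -> 'X_{1..3} -> S.

Lemma map_chart_mx : map_mx h (chart_mx c) = chart_mx (fun i m => h (c i m)).
Proof. by apply/matrixP => i t; rewrite !mxE. Qed.

Lemma map_gram m : map_mx h (gram c m) = gram (fun i m => h (c i m)) m.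
Proof.
apply/matrixP => i j; rewrite !mxE /dual_form rmorphB rmorphM rmorph_nat /=.
rewrite -det_map_mx map_chart_mx; congr (_ - _).
have mapE (X : 'rV_4) (Y : 'cV_4) :
    h ((X *m \adj (chart_mx c) *m Y) 0 0) =
    (map_mx h X *m \adj (chart_mx (fun i m => h (c i m))) *m map_mx h Y) 0 0.
  by rewrite -map_chart_mx -map_mx_adj -!map_mxM [RHS]mxE.
rewrite mapE; congr ((_ *m _ *m _) 0 0).
  by apply/rowP => t; rewrite !mxE rmorph_nat.
by apply/colP => t; rewrite !mxE.
Qed.

Lemma map_resolvent : h (resolvent c) = resolvent (fun i m => h (c i m)).
Proof.
rewrite /resolvent !rmorphM /= -!det_map_mx map_chart_mx -cubic_disc_map map_char_poly.
by rewrite map_mxM map_mx_adj !map_mxD !map_gram.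
Qed.

End ResolventMap.

Lemma quad_monC i j : quad_mon i j = quad_mon j i.
Proof. exact: addmC. Qed.

Lemma quad_monP (m : 'X_{1..3}) : mdeg m = 2 -> exists i j, m = quad_mon i j.
Proof.
have pick (m' : 'X_{1..3}) d : mdeg m' = d.+1 ->
    exists i m'', m' = (U_(i) + m'')%MM /\ mdeg m'' = d.
  move=> md; have [i mi] : exists i, m' i != 0%N.
    apply/existsP; apply: contra_eqT md; rewrite negb_exists => /forallP m0.
    rewrite mdegE big1 // => i _; apply/eqP; have := m0 i; by rewrite negbK.
  exists i, (m' - U_(i))%MM.
  have Um : (U_(i) <= m')%MM.
    by apply/mnm_lepP => j; rewrite mnm1E; case: eqP => [<-|//]; rewrite lt0n.
  have mE : m' = (U_(i) + (m' - U_(i)))%MM by rewrite addmC submK.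
  by split=> //; move: md; rewrite {1}mE mdegD mdeg1 => -[].
move=> /pick[i [m1 [-> /pick[j [m2 [-> /eqP]]]]]]; rewrite mdeg_eq0 => /eqP ->.
by exists i, j; rewrite addm0.
Qed.

Lemma quad_mon_eq i j i' j' : (quad_mon i j == quad_mon i' j') =
  ((i == i') && (j == j')) || ((i == j') && (j == i')).
Proof.
apply/eqP/idP; last first.
  by case/orP => /andP[/eqP-> /eqP->] //; rewrite quad_monC.
move=> e; have inj (a b : 'I_3) : U_(a)%MM = U_(b)%MM -> a = b.
  by move=> /mnmP/(_ a); rewrite !mnm1E eqxx; case: eqP.
have [ii|ii] := eqVneq i i'.
  rewrite ii in e *; have jj : j = j' by apply/inj/(@addmI _ U_(i')%MM).
  by rewrite jj eqxx.
have ij : i = j'.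
  have /mnmP/(_ i) := e; rewrite !mnmDE !mnm1E eqxx (eq_sym i') (negPf ii).
  by case: (j' =P i).
rewrite -ij (quad_monC i') in e *; have ji : j = i' by apply/inj/(@addmI _ U_(i)%MM).
by rewrite ji !eqxx orbT.
Qed.

Section Quadrics.
Variable K : fieldType.
Implicit Types q : {mpoly K[3]}.

Lemma quadric_eq0 q : q \is 2.-homog ->
  (forall r, q@_(quad_mon r r) = 0) -> (forall r, q@_(quad_mon r (r + 1)) = 0) ->
  q = 0.
Proof.
move=> qh qd qo; apply/mpolyP => m; rewrite mcoeff0.
have [/quad_monP[i [j ->]]|/eqP m2] := mdeg m =P 2;
  last exact: dhomog_nemf_coeff qh m2.
case: (ord3P i j) => ->; rewrite ?qd ?qo //.
by rewrite quad_monC -{2}(ord3_rot i) qo.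
Qed.

Lemma mcoeff_quad i j m : ('X_i * 'X_j : {mpoly K[3]})@_m = (quad_mon i j == m)%:R.
Proof. by rewrite -mpolyXD mcoeffX. Qed.

Lemma quadric_expand q : q \is 2.-homog ->
  q = \sum_r q@_(quad_mon r r) *: 'X_r ^+ 2
    + \sum_r q@_(quad_mon r (r + 1)) *: ('X_r * 'X_(r + 1)).
Proof.
move=> qh; apply/eqP; rewrite -subr_eq0; apply/eqP/quadric_eq0 => [|r|r].
- rewrite rpredB // rpredD //; apply: rpred_sum => r _; rewrite rpredZ //.
    by rewrite expr2 -mpolyXD dhomogX /= mdegD !mdeg1.
  by rewrite -mpolyXD dhomogX /= mdegD !mdeg1.
- rewrite mcoeffB mcoeffD !(big_ord3_rot _ r) !mcoeffD !mcoeffZ !expr2.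
  rewrite !mcoeff_quad !quad_mon_eq ord3_rot !eqxx !ord3_neq /=.
  by rewrite !(mulr0, mulr1, addr0) subrr.
- rewrite mcoeffB mcoeffD !(big_ord3_rot _ r) !mcoeffD !mcoeffZ !expr2.
  rewrite !mcoeff_quad !quad_mon_eq ord3_rot !eqxx !ord3_neq !(eq_sym r) !ord3_neq /=.
  by rewrite !(mulr0, mulr1, addr0, add0r) subrr.
Qed.

End Quadrics.

Section GenericFrame.
Variables (K : numClosedFieldType) (f : 'I_4 -> dhomog 3 K 2).

Definition form_coef (i : 'I_4) (m : 'X_{1..3}) : K := (mpoly_of_dhomog (f i))@_m.

Local Notation c := form_coef.

Definition dual_functional m (q : {mpoly K[3]}) : K :=
  dual_form c m (fun m' => q@_m').

Lemma dual_functionalD m p q :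
  dual_functional m (p + q) = dual_functional m p + dual_functional m q.
Proof.
rewrite /dual_functional /dual_form mcoeffD.
have -> : \row_t (p + q)@_(chart_mon t)
    = \row_t p@_(chart_mon t) + \row_t q@_(chart_mon t).
  by apply/rowP => t; rewrite !mxE mcoeffD.
by rewrite !mulmxDl [(_ + _ : 'M_1) 0 0]mxE; ring.
Qed.

Lemma dual_functionalZ m a q :
  dual_functional m (a *: q) = a * dual_functional m q.
Proof.
rewrite /dual_functional /dual_form mcoeffZ.
have -> : \row_t (a *: q)@_(chart_mon t) = a *: \row_t q@_(chart_mon t).
  by apply/rowP => t; rewrite !mxE mcoeffZ.
by rewrite -!scalemxAl [(_ *: _ : 'M_1) 0 0]mxE; ring.
Qed.

Lemma dual_functional_sum m T (s : seq T) (F : T -> {mpoly K[3]}) :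
  dual_functional m (\sum_(x <- s) F x) = \sum_(x <- s) dual_functional m (F x).
Proof.
elim: s => [|x s IHs]; last by rewrite !big_cons dual_functionalD IHs.
by rewrite !big_nil -[0 in LHS](scale0r 0) dual_functionalZ mul0r.
Qed.

(** The chart coefficients of [f i] form a row of [chart_mx]; times the adjugate this is the
    determinant times a unit row, so both terms cancel. *)
Lemma dual_functional_form m i : dual_functional m (f i) = 0.
Proof.
rewrite /dual_functional /dual_form -/(c i _).
have -> : \row_t (mpoly_of_dhomog (f i))@_(chart_mon t) = row i (chart_mx c).
  by apply/rowP => t; rewrite !mxE.
by rewrite -!row_mul mul_mx_adj mul_scalar_mx !mxE subrr.
Qed.

(** Solving for the chart coefficients leaves a remainder supported on $x^2$ and $y^2$, where its
    coefficients are, up to the determinant, the two functionals. *)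
Lemma dual_functional_span q : \det (chart_mx c) != 0 -> q \is 2.-homog ->
  dual_functional (quad_mon 0 0) q = 0 -> dual_functional (quad_mon 1 1) q = 0 ->
  exists a : 'I_4 -> K, q = \sum_i a i *: mpoly_of_dhomog (f i).
Proof.
move=> det0 qh q00 q11; pose a := (\row_t q@_(chart_mon t)) *m invmx (chart_mx c).
exists (a 0); apply/eqP; rewrite -subr_eq0; apply/eqP.
set p := _ - _.
have chart_unit : chart_mx c \in unitmx by rewrite unitmxE unitfE.
have coefE m : (\sum_i a 0 i *: mpoly_of_dhomog (f i))@_m
    = (a *m \col_i c i m) 0 0.
  rewrite raddf_sum /= mxE; apply: eq_bigr => i _.
  by rewrite mcoeffZ [X in _ = _ * X]mxE.
have p_chart t : p@_(chart_mon t) = 0.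
  rewrite mcoeffB coefE; apply/eqP; rewrite subr_eq0; apply/eqP.
  have : (a *m chart_mx c) 0 t = (\row_t q@_(chart_mon t)) 0 t by rewrite mulmxKV.
  rewrite [RHS]mxE => <-; rewrite !mxE; apply: eq_bigr => i _.
  by rewrite ![chart_mx _ _ _]mxE [(\col__ _) _ _]mxE.
have p_dual m : dual_functional m q = 0 -> p@_m = 0.
  move=> qm; apply: (mulfI det0); rewrite mulr0 mcoeffB coefE mulrBr -{1}qm.
  rewrite /a /invmx chart_unit -scalemxAr -scalemxAl [(_ *: _ : 'M_1) 0 0]mxE.
  by rewrite mulVKf //; rewrite qm; move: qm;
    rewrite /dual_functional /dual_form.
have ord3_cases (r : 'I_3) : [\/ r = 0, r = 1 | r = 1 + 1] :> Prop.
  by have := ord3P 0 r; rewrite !add0r.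
apply: quadric_eq0 => [|r|r].
- rewrite rpredB // rpred_sum // => i _; rewrite rpredZ //.
  exact: dhomog_is_dhomog.
- case: (ord3_cases r) => ->; [exact: p_dual | exact: p_dual |].
  exact: (p_chart (Ordinal (isT : 3 < 4)%N)).
case: (ord3_cases r) => ->; rewrite ?add0r.
- exact: (p_chart (Ordinal (isT : 0 < 4)%N)).
- exact: (p_chart (Ordinal (isT : 1 < 4)%N)).
rewrite -[X in X + 1 + 1]add0r ord3_rot.
exact: (p_chart (Ordinal (isT : 2 < 4)%N)).
Qed.

Lemma dual_functional_lin m (P : 'M[K]_3) i j :
  dual_functional m (linear_form P i * linear_form P j)
    = (P *m gram c m *m P^T) i j.
Proof.
rewrite /linear_form mulr_suml dual_functional_sum mxE.
under eq_bigr => a _ do rewrite mulr_sumr dual_functional_sum.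
rewrite exchange_big; apply: eq_bigr => b _;
  rewrite [X in _ = X * _]mxE mulr_suml.
apply: eq_bigr => a _; rewrite -scalerAl -scalerAr scalerA dual_functionalZ.
rewrite [P^T _ _]mxE [gram _ _ _ _]mxE mulrAC; congr (_ * _ * _).
by rewrite /dual_functional; apply: eq_dual_form => m'; exact: mcoeff_quad.
Qed.

Lemma dual_functional_is_scalar m : scalar (dual_functional m).
Proof. by move=> a p q; rewrite dual_functionalD dual_functionalZ. Qed.

HB.instance Definition _ m := GRing.isLinear.Build K {mpoly K[3]} K _
  (dual_functional m) (dual_functional_is_scalar m).

Lemma dual_pencil : \det (chart_mx c) != 0 ->
  exists phi psi : {scalar {mpoly K[3]}},
  [/\ forall q, q \is 2.-homog -> phi q = 0 -> psi q = 0 -> q \in forms_ideal f,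
      forall i, phi (f i) = 0 /\ psi (f i) = 0,
      forall (P : 'M_3) i j, phi (linear_form P i * linear_form P j)
        = (P *m gram0 c *m P^T) i j
    & forall (P : 'M_3) i j, psi (linear_form P i * linear_form P j)
        = (P *m gram1 c *m P^T) i j].
Proof.
move=> det0; pose phi0 : {scalar {mpoly K[3]}} := dual_functional (quad_mon 0 0).
pose psi : {scalar {mpoly K[3]}} := dual_functional (quad_mon 1 1).
exists (phi0 \+ psi : {scalar _}), psi; split=> [q qh||P i j|P i j].
- rewrite /= => + q1; rewrite q1 addr0 => q0.
  have [d ->] := dual_functional_span det0 qh q0 q1.
  apply: rpred_sum => i _; rewrite -mulr_algl absorbMl //.
  apply/asboolP; exists 1%N, (fun=> 1), (fun=> mpoly_of_dhomog (f i)).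
  by split=> [_|]; [exists i | rewrite big_ord1 mul1r].
- by move=> i; split; rewrite /= !dual_functional_form ?addr0.
- by rewrite /= !dual_functional_lin /gram0 mulmxDr mulmxDl [RHS]mxE.
- exact: dual_functional_lin.
Qed.

End GenericFrame.

Lemma scalar_frame (K : fieldType) (phi : {scalar {mpoly K[3]}})
    (l : 'I_3 -> {mpoly K[3]}) (e u v : 'I_3 -> K) :
  (forall i j, phi (l i * l j) = if i == j then e i else 0) ->
  phi (\sum_r u r *: l r ^+ 2 + \sum_r v r *: (l r * l (r + 1)))
    = \sum_r u r * e r.
Proof.
move=> phil; rewrite linearD !linear_sum /= [X in _ + X]big1 => [|r _].
  by rewrite addr0; apply: eq_bigr => r _; rewrite linearZ /= expr2 phil eqxx.
by rewrite linearZ /= phil eq_sym ord3_neq mulr0.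
Qed.

(* The vectors [a] and [b] span the orthogonal complement of [(1, 1, 1)] *)
Lemma orthogonal_const (K : fieldType) (a b u : 'I_3 -> K) :
  \sum_r a r = 0 -> \sum_r b r = 0 -> a 0 * b 1 - a 1 * b 0 != 0 ->
  \sum_r u r * a r = 0 -> \sum_r u r * b r = 0 -> forall r, u r = u 0.
Proof.
rewrite !(big_ord3_rot _ 0) add0r => a0 b0 ab ua ub.
(* The third entries of [a] and [b] are eliminated through their zero sums, leaving a two by two
   system of determinant [ab]. *)
have ua' : (u 0 - u (1 + 1)) * a 0 + (u 1 - u (1 + 1)) * a 1 = 0.
  rewrite -[RHS]ua -[LHS]addr0 -(mulr0 (u (1 + 1))) -a0; ring.
have ub' : (u 0 - u (1 + 1)) * b 0 + (u 1 - u (1 + 1)) * b 1 = 0.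
  rewrite -[RHS]ub -[LHS]addr0 -(mulr0 (u (1 + 1))) -b0; ring.
have u02 : u (1 + 1) = u 0.
  apply/esym/eqP; rewrite -subr_eq0 -(mulIr_eq0 _ (mulIf ab)); apply/eqP.
  transitivity (((u 0 - u (1 + 1)) * a 0 + (u 1 - u (1 + 1)) * a 1) * b 1
    - ((u 0 - u (1 + 1)) * b 0 + (u 1 - u (1 + 1)) * b 1) * a 1); first by ring.
  by rewrite ua' ub' !mul0r subr0.
have u01 : u 1 = u 0.
  apply/eqP; rewrite -subr_eq0 -(mulIr_eq0 _ (mulIf ab)); apply/eqP.
  rewrite -u02; transitivity (
    ((u 0 - u (1 + 1)) * b 0 + (u 1 - u (1 + 1)) * b 1) * a 0
    - ((u 0 - u (1 + 1)) * a 0 + (u 1 - u (1 + 1)) * a 1) * b 0); first by ring.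
  by rewrite ua' ub' !mul0r subr0.
by move=> r; case: (ord3P 0 r) => ->; rewrite ?add0r.
Qed.

(** In the frame both members of the pencil are diagonal of trace zero, so they kill the cross
    products and the sum of squares, which puts these in the ideal. Conversely they kill each [f i],
    whose square coefficients are therefore all equal. *)
Lemma generic_frame (K : numClosedFieldType) (f : 'I_4 -> dhomog 3 K 2) :
  resolvent (form_coef f) != 0 -> exists M N : 'M[K]_3,
  [/\ M *m N = 1%:M,
      forall r, linear_form M r * linear_form M (r + 1) \in forms_ideal f,
      \sum_r linear_form M r ^+ 2 \in forms_ideal f
    & forall i, exists a (d : 'I_3 -> K), mpoly_of_dhomog (f i) =
        a *: (\sum_r linear_form M r ^+ 2)
        + \sum_r d r *: (linear_form M r * linear_form M (r + 1))].
Proof.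
rewrite /resolvent !mulf_eq0 !negb_or -andbA => /and3P[det0 detA disc].
have [phi [psi [in_span f0 phiM psiM]]] := dual_pencil det0.
have [M [a [b [Mu MA MB [a0 b0] ab]]]] :=
  pencil_frame (gram0_sym _) (gram_sym _ _) detA disc.
have {}phiM i j : phi (linear_form M i * linear_form M j) = if i == j then a i else 0.
  by rewrite phiM MA !mxE; case: eqP => [->|_]; rewrite ?mulr1n ?mulr0n.
have {}psiM i j : psi (linear_form M i * linear_form M j) = if i == j then b i else 0.
  by rewrite psiM MB !mxE; case: eqP => [->|_]; rewrite ?mulr1n ?mulr0n.
have lh i j : linear_form M i * linear_form M j \is 2.-homog.
  exact: dhomogM (linear_form_homog M i) (linear_form_homog M j).
have r1 (r : 'I_3) : (r == r + 1) = false by rewrite eq_sym ord3_neq.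
have sum_squares (chi : {scalar {mpoly K[3]}}) (e : 'I_3 -> K) :
    (forall i j, chi (linear_form M i * linear_form M j) = if i == j then e i else 0) ->
    chi (\sum_r linear_form M r ^+ 2) = \sum_r e r.
  by move=> chiM; rewrite linear_sum; apply: eq_bigr => r _;
    rewrite expr2 chiM eqxx.
exists M, (invmx M); split; first exact: mulmxV.
- by move=> r; apply: in_span; rewrite ?lh ?phiM ?psiM ?r1.
- apply: in_span; rewrite ?(sum_squares _ _ phiM) ?(sum_squares _ _ psiM) //.
  by apply: rpred_sum => r _; exact: lh.
move=> i; have gh := linear_subst_homog (invmx M) (dhomog_is_dhomog (f i)).
set g := linear_subst _ _ in gh.
pose u r := g@_(quad_mon r r); pose v r := g@_(quad_mon r (r + 1)).
have fE : mpoly_of_dhomog (f i) = \sum_r u r *: linear_form M r ^+ 2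
    + \sum_r v r *: (linear_form M r * linear_form M (r + 1)).
  have -> : mpoly_of_dhomog (f i) = linear_subst M g.
    by rewrite /g linear_substK // mulVmx.
  rewrite (quadric_expand gh) rmorphD !rmorph_sum /=.
  congr (_ + _); apply: eq_bigr => r _; rewrite linear_substZ.
    by rewrite rmorphXn /= linear_substX.
  by rewrite rmorphM /= !linear_substX.
have [phif psif] := f0 i; rewrite fE in phif psif.
have u0 := orthogonal_const a0 b0 ab (etrans (esym (scalar_frame u v phiM)) phif)
  (etrans (esym (scalar_frame u v psiM)) psif).
exists (u 0), v; rewrite fE; congr (_ + _); rewrite [RHS]scaler_sumr.
by apply: eq_bigr => r _; rewrite u0.
Qed.

(** * Genericity *)

Section GenericPoint.
Variable K : numClosedFieldType.
Local Notation V := {ffun 'I_4 -> dhomog 3 K 2}.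

Lemma form_coef_sum (T : Type) (s : seq T) (a : T -> K) (F : T -> V) i m :
  form_coef (\sum_(x <- s) a x *: F x) i m = \sum_(x <- s) a x * form_coef (F x) i m.
Proof.
rewrite /form_coef; elim: s => [|x s IHs].
  by rewrite !big_nil ffunE /= mcoeff0.
by rewrite !big_cons !ffunE /= mcoeffD mcoeffZ IHs.
Qed.

Definition generic_coef i m : {mpoly K[\dim {:V}]} :=
  \sum_(t < \dim {:V}) form_coef (vbasis {:V})`_t i m *: 'X_t.

Lemma generic_coef_eval (v : V) i m :
  (generic_coef i m).@[fun t => coord (vbasis {:V}) t v] = form_coef v i m.
Proof.
rewrite [in RHS](coord_vbasis (memvf v)) form_coef_sum raddf_sum /=.
by apply: eq_bigr => t _; rewrite mevalZ mevalXU mulrC.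
Qed.

(** The complement is the zero set of one polynomial, the resolvent of the generic coefficients. *)
Lemma resolvent_open : zariski_open [set v : V | resolvent (form_coef v) != 0].
Proof.
exists [set resolvent generic_coef]; apply/seteqP.
have evalE (v : V) : (resolvent generic_coef).@[fun t => coord (vbasis {:V}) t v]
    = resolvent (form_coef v).
  rewrite [LHS](map_resolvent (meval (fun t => coord (vbasis {:V}) t v))).
  congr resolvent; apply/funext => i; apply/funext => m;
    exact: generic_coef_eval.
split=> v /=.
  by move=> /negP/negPn/eqP rv p ->; rewrite evalE.
by move=> /(_ _ erefl); rewrite evalE => ->; rewrite eqxx.
Qed.

(* Chosen so that [gram0] is the identity matrix. *)
Definition sample_quadric (t : 'I_4) : {mpoly K[3]} :=
  if t == ord_max then - 2 *: ('X_0 * 'X_0) + 'X_1 * 'X_1 + 'X_(1 + 1) * 'X_(1 + 1)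
  else 'X_(chart_pair t).1 * 'X_(chart_pair t).2.

Lemma sample_quadric_homog t : sample_quadric t \is 2.-homog.
Proof.
have XX i j : 'X_i * 'X_j \is [in K[3], 2.-homog].
  by rewrite -mpolyXD dhomogX /= mdegD !mdeg1.
by rewrite /sample_quadric; case: ifP => _ //; rewrite !rpredD ?rpredZ.
Qed.

Definition sample_forms : V := [ffun t => DHomog (sample_quadric_homog t)].

Lemma sample_coef t m : form_coef sample_forms t m = (sample_quadric t)@_m.
Proof. by rewrite /form_coef ffunE. Qed.

Lemma sample_chart_mx : chart_mx (form_coef sample_forms) = 1%:M.
Proof.
apply/matrixP => i t; rewrite !mxE sample_coef /sample_quadric.
case: i t => [[|[|[|[|//]]]] ?] [[|[|[|[|//]]]] ?] /=;
by rewrite ?(mcoeffD, mcoeffZ) !mcoeff_quad !quad_mon_eq /= ?mulr0 ?add0r ?addr0.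
Qed.

(** The chart matrix is the identity, and only the last quadric contains the square of ['X_r], with
    coefficient $-2$ or $1$. *)
Lemma sample_gram r : r != 1 + 1 -> gram (form_coef sample_forms) (quad_mon r r) =
  diag_mx (\row_i ((i == r)%:R - (i == 1 + 1)%:R * (if r == 0 then - 2 else 1))).
Proof.
move=> r2; apply/matrixP => i j; rewrite !mxE /dual_form sample_chart_mx det1 adj1 mulmx1 mul1r.
rewrite mxE (bigD1 ord_max) //= big1 ?addr0 => [|t tmax]; last first.
  rewrite [(\col__ _) _ _]mxE sample_coef /sample_quadric (negPf tmax) mcoeff_quad.
  rewrite quad_mon_eq orbb.
  suff -> : ((chart_pair t).1 == r) && ((chart_pair t).2 == r) = false by rewrite mulr0.
  apply/negbTE; apply: contra tmax => /andP[/eqP + /eqP]; move=> <-.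
  by case: t => [[|[|[|[|//]]]] ?].
rewrite !mxE sample_coef /sample_quadric eqxx !(mcoeffD, mcoeffZ) !mcoeff_quad.
rewrite /chart_mon !quad_mon_eq /=.
case: r r2 => [[|[|[|//]]] ?] // _;
  case: i => [[|[|[|//]]] ?]; case: j => [[|[|[|//]]] ?] /=; ring.
Qed.

Lemma sample_resolvent : resolvent (form_coef sample_forms) != 0.
Proof.
have g0 : gram0 (form_coef sample_forms) = 1%:M.
  rewrite /gram0 !sample_gram // -linearD -diag_const_mx; congr diag_mx.
  apply/rowP => i; rewrite !mxE; case: i => [[|[|[|//]]] ?] /=; ring.
rewrite /resolvent sample_chart_mx g0 !det1 !mul1r adj1 mulmx1 /gram1 sample_gram //.
(* Here [gram1] is diagonal with entries $0$, $1$, $-1$, which are distinct because $2$ is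
   nonzero. *)
rewrite char_poly_trig ?diag_mx_is_trig // prod_ord3 cubic_disc_roots !mxE /=.
rewrite expf_eq0 /= !mulf_eq0 !negb_or.
have two : 1 + 1 != 0 :> K by rewrite -[1 + 1]/(2%:R) pnatr_eq0.
by rewrite !(mulr1n, mul0r, mulr1, subr0, sub0r, opprK) oppr_eq0 oner_eq0 two.
Qed.

End GenericPoint.

Theorem theorem8 (R : realType) (k : nat) (hk : (1 <= k)%N) :
  @holds_generically R[i] {ffun 'I_4 -> dhomog 3 R[i] 2}
    (fun f => is_hilbert_series
       (graded_piece (ideal_exp (forms_ideal f) k))
       (fun d => (\sum_(0 <= i < 2 * k) 'C(i + 2, 2) *: 'X^i
                    + (3 * k - 1)%N *: 'X^(2 * k) : {poly nat})`_d)).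
Proof.
(* The same open set serves every [k]. *)
exists [set v : {ffun 'I_4 -> dhomog 3 R[i] 2} | resolvent (form_coef v) != 0];
  split.
- exact: resolvent_open.
- by exists (sample_forms _); exact: sample_resolvent.
move=> f /= /generic_frame[M [N [MN1 cross squares forms]]].
exact: (steiner_hilbert_series MN1 cross squares forms hk).
Qed.
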